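(* Let $X$ be a Banach space of analytic functions on the open unit disk $\mathbb{D}$ such that (i) the disk algebra $\mathcal{A}(\mathbb{D})$ is continuously embedded in $X$, and (ii) $X$ is continuously embedded in $\mathrm{Hol}(\mathbb{D})$. Let $(\lambda_n)_{n\geq 1}$ be a sequence in $\mathbb{D}$ with $\sum_{n\ge 1}(1-|\lambda_n|)=\infty$, and define $B_0=1$ and $B_n(z)=\prod_{k=1}^n \frac{\lambda_k-z}{1-\overline{\lambda}_k z}$ for $n\ge 1$. Then the sequence of finite Blaschke products $(B_n)_{n\ge 0}$ is a Schauder basis of $\mathrm{Hol}(\overline{\mathbb{D}})$ equipped with the norm of $X$.
   Context: $\mathrm{Hol}(\overline{\mathbb{D}})$ is the space of functions analytic in a neighborhood of the closed unit disk $\overline{\mathbb{D}}$. $\mathrm{Hol}(\mathbb{D})$ is the space of analytic functions on $\mathbb{D}$ with the topology of uniform convergence on compact subsets of $\mathbb{D}$. The disk algebra is $\mathcal{A}(\mathbb{D})=\mathrm{Hol}(\mathbb{D})\cap C(\overline{\mathbb{D}})$ with the sup norm. A sequence $(x_n)_{n\ge 0}$ in a complex topological linear space $\mathcal{X}$ is a Schauder basis for $\mathcal{X}$ if for each $x\in\mathcal{X}$ there is a unique sequence $(a_n)_{n\ge 0}$ of complex numbers such that $x=\sum_{n=0}^\infty a_nx_n$, with convergence in the topology of $\mathcal{X}$ (here $\mathcal{X}=\mathrm{Hol}(\overline{\mathbb{D}})$ with the norm inherited from $X$; no completeness of $\mathcal{X}$ is required). *)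

(* Defs.v *)
From HB Require Import structures.
From mathcomp Require Import all_boot all_order all_algebra.
From mathcomp Require Import complex.
From mathcomp Require Import all_classical all_reals all_analysis.

Set Implicit Arguments.
Unset Strict Implicit.
Unset Printing Implicit Defensive.

Import Order.TTheory GRing.Theory Num.Theory.
Import numFieldNormedType.Exports.
Local Open Scope classical_set_scope.
Local Open Scope ring_scope.
Local Open Scope complex_scope.

(* The complex numbers, declared as a [numClosedFieldType] so that
   [numFieldNormedType] supplies their topology and norm. *)
Definition Cplx (R : realType) : numClosedFieldType := R[i].
Arguments Cplx : simpl never.

Section Defs.
Variable R : realType.
Local Notation C := (Cplx R).

Definition disk : set C := [set z | `|z| < 1].
Definition cdisk : set C := [set z | `|z| <= 1].

(* Functions on a subset of the plane are total functions [C -> C] whose values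
   outside the subset are irrelevant. *)

Definition analytic_at (f : C -> C) (z0 : C) : Prop :=
  exists c : nat -> C,
    \forall z \near z0, series (fun k => c k * (z - z0) ^+ k) @ \oo --> f z.

Definition analytic_on (U : set C) (f : C -> C) : Prop :=
  forall z, U z -> analytic_at f z.

Definition hol_cdisk : set (C -> C) :=
  [set f | exists U : set C, [/\ open U, cdisk `<=` U & analytic_on U f]].

Definition disk_algebra : set (C -> C) :=
  [set f | analytic_on disk f /\ {within cdisk, continuous f}].

(* [ev x] is the function on the disk that the vector [x] is. *)
Definition space_of_analytic_functions (X : lmodType C) (ev : X -> C -> C) :
    Prop :=
  [/\ forall (a : C) (x y : X) (z : C), disk z ->
        ev (a *: x + y) z = a * ev x z + ev y z,
      forall x y : X, (forall z, disk z -> ev x z = ev y z) -> x = y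
    & forall x : X, analytic_on disk (ev x)].

Definition embedded_in_hol_disk (X : topologicalType) (ev : X -> C -> C) :
    Prop :=
  continuous
    (ev : X -> {family [set K : set C | compact K /\ K `<=` disk], C -> C}).

(* [j] is the inclusion of the disk algebra into [X]; its values outside
   [disk_algebra] are irrelevant. *)
Definition disk_algebra_embedded (X : topologicalType) (ev : X -> C -> C)
    (j : (C -> C) -> X) : Prop :=
  (forall f, disk_algebra f -> forall z, disk z -> ev (j f) z = f z) /\
  {within (disk_algebra : set {uniform` cdisk -> C}),
     continuous (j : {uniform` cdisk -> C} -> X)}.

(* Schauder basis of the linear subspace [S] of [V], with the topology induced
   by [V]. *)
Definition schauder_basis (V : topologicalLmodType C) (S : set V)
    (b : nat -> V) : Prop :=
  (forall n, S (b n)) /\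
  forall x, S x ->
    exists! a : nat -> C, series (fun n => a n *: b n) @ \oo --> x.

Definition blaschke (lam : nat -> C) (n : nat) (z : C) : C :=
  \prod_(1 <= k < n.+1) ((lam k - z) / (1 - (lam k)^* * z)).

End Defs.

(* Main.v *)
Require Import Defs.
From HB Require Import structures.
From mathcomp Require Import all_boot all_order all_algebra.
From mathcomp Require Import complex.
From mathcomp Require Import all_classical all_reals all_analysis.
From mathcomp Require Import ring lra.

Set Implicit Arguments.
Unset Strict Implicit.
Unset Printing Implicit Defensive.

Import Order.TTheory GRing.Theory Num.Theory.
Import numFieldNormedType.Exports.
Local Open Scope classical_set_scope.
Local Open Scope ring_scope.

(** Existence. Let [f] be analytic on the disk of radius [rho > 1], and
    consider first the kernel [1 / (1 - z * u)] with [modc u < 1].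
    Interpolating it in [z] at the points [lam 1], [lam 2], ... by
    combinations of finite Blaschke products leaves a remainder that is
    explicit ([newton_expansion]): up to bounded factors it is a Blaschke
    product in [z], of modulus at most one, times the Blaschke product in
    [u] whose zeros are the conjugates of the [lam k]. Because the sum of
    the [1 - modc (lam k)] diverges, the latter tends to [0] uniformly on
    every smaller disk ([blaschke_decay]). The kernel generates the
    monomials, since the coefficient of [u ^ m] is [z ^+ m]; so Cauchy
    estimates in [u] show that [z ^+ m] is approximated by combinations of
    Blaschke products, uniformly on the closed unit disk, with an error
    [eps n * s ^- m] for any [s < 1]. Summing these against the Taylor
    coefficients of [f], which are of order [rho ^- m], gives an expansion
    of [f] that converges in the sup norm of the closed disk
    ([blaschke_expansion]), hence in the norm of [X] because the disk
    algebra embeds continuously ([inclusion_cvg]).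

    Uniqueness. A series of Blaschke products that tends to [0] in [X] tends
    to [0] uniformly on the compact subsets of the disk
    ([cvg0_locally_uniform]). The coefficients can then be read off
    successively, as in Newton interpolation: if [d p] is the first nonzero
    one, division by [blaschke lam p] and evaluation at [lam p.+1] isolate
    it, and the maximum modulus principle shows that the division preserves
    the convergence to [0] ([blaschke_coef_unique]).

    Both halves need some function theory, with analytic functions given as
    local sums of power series. It is derived here without integration. The
    maximum modulus principle ([maximum_modulus]) comes from sums over four
    points [a + i ^ j s] and compactness; averaging over rotations by roots
    of unity turns it into the Cauchy estimates ([cauchy_estimate]); and
    these show that the Taylor series at the centre of a disk represents the
    function in the whole disk ([analytic_has_ps]). *)

(** * The real-valued modulus *)

(** The library norm of [Cplx R] takes its values in [Cplx R]; suprema,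
    compactness arguments and numerical bounds need a modulus in the
    complete ordered field [R]. *)
Definition modc (R : realType) (z : Cplx R) : R := Normc.normc z.

Section Modulus.
Variable R : realType.
Local Notation C := (Cplx R).
Local Notation "r %:C" := (real_complex R r : C).
Implicit Types (z w h u : C) (r : R) (f g : C -> C) (c d : nat -> C).

Lemma normr_modc z : `|z| = (modc z)%:C.
Proof. by []. Qed.

Lemma lec_real (x y : R) : (x%:C <= y%:C) = (x <= y).
Proof. exact: lecR. Qed.

Lemma ltc_real (x y : R) : (x%:C < y%:C) = (x < y).
Proof. exact: ltcR. Qed.

Lemma modc_ge0 z : 0 <= modc z.
Proof. by rewrite -lec_real -normr_modc; exact: normr_ge0. Qed.

Lemma modcM z w : modc (z * w) = modc z * modc w.
Proof. exact: Normc.normcM. Qed.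

Lemma modcV z : modc z^-1 = (modc z)^-1.
Proof. exact: Normc.normcV. Qed.

Lemma modc0 : modc (0 : C) = 0.
Proof. exact: Normc.normc0. Qed.

Lemma modc1 : modc (1 : C) = 1.
Proof. exact: Normc.normc1. Qed.

Lemma modcN z : modc (- z) = modc z.
Proof. exact: normcN. Qed.

Lemma modcD z w : modc (z + w) <= modc z + modc w.
Proof. exact: le_normcD. Qed.

Lemma modcB z w : modc (z - w) <= modc z + modc w.
Proof. by rewrite -(modcN w) modcD. Qed.

Lemma modc_distC z w : modc (z - w) = modc (w - z).
Proof. by rewrite -modcN opprB. Qed.

Lemma modcBr z w : modc z - modc w <= modc (z - w).
Proof. by rewrite lerBlDr -{1}(subrK w z) modcD. Qed.

Lemma modc_eq0 z : (modc z == 0) = (z == 0).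
Proof.
by apply/eqP/eqP => [|->]; [exact: Normc.eq0_normc | exact: modc0].
Qed.

Lemma modc_gt0 z : (0 < modc z) = (z != 0).
Proof. by rewrite lt_def modc_eq0 modc_ge0 andbT. Qed.

Lemma modcX z n : modc (z ^+ n) = modc z ^+ n.
Proof.
by elim: n => [|n IH]; rewrite ?expr0 ?modc1 // !exprS modcM IH.
Qed.

Lemma modc_conj z : modc (conjc z) = modc z.
Proof. by case: z => a b; rewrite /modc /= sqrrN. Qed.

Lemma modc_real (x : R) : modc x%:C = `|x|.
Proof. by rewrite /modc /= expr0n /= addr0 sqrtr_sqr. Qed.

Lemma modc_nat n : modc (n%:R : C) = n%:R.
Proof.
by rewrite -(rmorph_nat (real_complex R)) modc_real ger0_norm ?ler0n.
Qed.

Lemma modc_sum (I : Type) (r : seq I) (P : pred I) (F : I -> C) :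
  modc (\sum_(i <- r | P i) F i) <= \sum_(i <- r | P i) modc (F i).
Proof.
elim/big_ind2: _ => //; first by rewrite modc0.
by move=> z x w y hz hw; apply: (le_trans (modcD _ _)); apply: lerD.
Qed.

Lemma modc_prod (I : Type) (r : seq I) (P : pred I) (F : I -> C) :
  modc (\prod_(i <- r | P i) F i) = \prod_(i <- r | P i) modc (F i).
Proof. by rewrite (big_morph _ modcM modc1). Qed.

Lemma one_sub_neq0 z w : modc z * modc w < 1 -> 1 - z * w != 0.
Proof.
move=> zw; apply/eqP => /subr0_eq zw1; move: zw.
by rewrite -modcM -zw1 modc1 ltxx.
Qed.

Lemma modc_parallelogram z h :
  modc (z + h) ^+ 2 + modc (z - h) ^+ 2 = 2 * modc z ^+ 2 + 2 * modc h ^+ 2.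
Proof.
case: z => a b; case: h => a' b'; rewrite /modc /=.
by rewrite !sqr_sqrtr ?addr_ge0 ?sqr_ge0 //; ring.
Qed.

(** This identity says that [(a - z) / (1 - conjc a * z)] maps the disk to
    itself, and measures by how much its modulus falls short of [1]. *)
Lemma modc_mobius (a z : C) :
  modc (1 - conjc a * z) ^+ 2 =
  modc (a - z) ^+ 2 + (1 - modc a ^+ 2) * (1 - modc z ^+ 2).
Proof.
case: a => x y; case: z => x' y'; rewrite /modc /=.
by rewrite !sqr_sqrtr ?addr_ge0 ?sqr_ge0 //; ring.
Qed.

Lemma modc_ge_Re z : `|complex.Re z| <= modc z.
Proof.
by case: z => x y; rewrite /modc /= -sqrtr_sqr ler_wsqrtr // lerDl sqr_ge0.
Qed.

Lemma modc_ge_Im z : `|complex.Im z| <= modc z.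
Proof.
by case: z => x y; rewrite /modc /= -sqrtr_sqr ler_wsqrtr // lerDr sqr_ge0.
Qed.

Lemma modc_le_ReIm z : modc z <= `|complex.Re z| + `|complex.Im z|.
Proof.
case: z => x y; rewrite /modc /= -[leRHS](@ger0_norm R) ?addr_ge0 //.
rewrite -sqrtr_sqr ler_wsqrtr // sqrrD !real_normK ?num_real // lerD2r lerDl.
by rewrite mulrn_wge0 ?mulr_ge0.
Qed.

Lemma Re_sum (I : Type) (r : seq I) (P : pred I) (F : I -> C) :
  complex.Re (\sum_(i <- r | P i) F i) = \sum_(i <- r | P i) complex.Re (F i).
Proof.
by apply: (big_morph (fun z : C => complex.Re z)) => // -[x y] [x' y'].
Qed.

Lemma Im_sum (I : Type) (r : seq I) (P : pred I) (F : I -> C) :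
  complex.Im (\sum_(i <- r | P i) F i) = \sum_(i <- r | P i) complex.Im (F i).
Proof.
by apply: (big_morph (fun z : C => complex.Im z)) => // -[x y] [x' y'].
Qed.

Lemma gt0_real (e : C) : 0 < e -> exists2 d : R, 0 < d & e = d%:C.
Proof.
move=> e0; have /complex_realP[d de] : (e : R[i]) \is Num.real.
  exact: gtr0_real.
by exists d => //; rewrite -ltc_real -de.
Qed.

Lemma cvg_modcP (T : Type) (F : set_system T) {FF : Filter F}
    (f : T -> C) (l : C) :
  f @ F --> l <->
  forall e : R, 0 < e -> \forall x \near F, modc (l - f x) < e.
Proof.
split=> [/cvgrPdist_lt h e e0|h].
  have := h e%:C; rewrite ltc_real => /(_ e0).
  by apply: filterS => x; rewrite normr_modc ltc_real.
apply/cvgrPdist_lt => e /gt0_real[d d0 ->].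
by apply: filterS (h d d0) => x; rewrite normr_modc ltc_real.
Qed.

Lemma cvg_Re_Im (T : Type) (F : set_system T) {FF : Filter F}
    (f : T -> C) (l : C) :
  (fun x => complex.Re (f x)) @ F --> complex.Re l ->
  (fun x => complex.Im (f x)) @ F --> complex.Im l -> f @ F --> l.
Proof.
move=> /cvgrPdist_lt cre /cvgrPdist_lt cim; apply/cvg_modcP => e e0.
have e20 : 0 < e / 2 by rewrite divr_gt0.
near=> x; apply: (le_lt_trans (modc_le_ReIm _)).
rewrite [ltRHS]splitr; apply: ltrD.
- rewrite (_ : complex.Re _ = complex.Re l - complex.Re (f x)).
    by near: x; exact: cre.
  by case: (l) (f x) => x1 y1 [x2 y2].
- rewrite (_ : complex.Im _ = complex.Im l - complex.Im (f x)).
    by near: x; exact: cim.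
  by case: (l) (f x) => x1 y1 [x2 y2].
Unshelve. all: by end_near. Qed.

Lemma nbhs_modcP (z0 : C) (P : set C) :
  nbhs z0 P <->
  exists2 r : R, 0 < r & forall h, modc h < r -> P (z0 + h).
Proof.
split.
  move=> /nbhs_ballP[e /= /gt0_real[d d0 ->] hP]; exists d => // h hd.
  apply: hP; rewrite -ball_normE /= normr_modc ltc_real.
  by rewrite opprD addrA subrr sub0r modcN.
move=> [r r0 hP]; apply/nbhs_ballP; exists r%:C => /=.
  by rewrite ltc_real.
move=> z; rewrite -ball_normE /= normr_modc ltc_real => zr.
by rewrite -(subrK z0 z) addrC; apply: hP; rewrite modc_distC.
Qed.

Lemma continuous_modc (T : topologicalType) (f : T -> C) (x : T) :
  {for x, continuous f} -> {for x, continuous (fun y => modc (f y))}.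
Proof.
move=> /cvg_modcP fx; apply/cvgrPdist_lt => e e0.
apply: filterS (fx e e0) => y; apply: le_lt_trans.
rewrite ler_norml modcBr andbT lerNl opprB modc_distC; exact: modcBr.
Qed.

Lemma modc_continuous : continuous (@modc R).
Proof. by move=> z; apply: (@continuous_modc C id z); exact: cvg_id. Qed.

Lemma modc_lim_le (u : nat -> C) (l z : C) (b : R) :
  u @ \oo --> l -> (\forall n \near \oo, modc (u n - z) <= b) ->
  modc (l - z) <= b.
Proof.
move=> /cvg_modcP ul ub; apply/ler_addgt0Pr => e e0.
suff : \forall n \near \oo, modc (l - z) <= b + e.
  by case=> n _ h; exact: (h n (leqnn n)).
near=> n; rewrite (_ : l - z = (u n - z) + (l - u n)); last by ring.
apply: (le_trans (modcD _ _)); apply: lerD; first by near: n.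
by apply: ltW; near: n; exact: ul.
Unshelve. all: by end_near. Qed.

(** The disk is a closed subset of the image of a square of [R * R]. *)
Lemma compact_modc_le r : compact [set z : C | modc z <= r].
Proof.
pose m (p : R * R) : C := (p.1 +i* p.2)%C.
have mc : continuous m.
  by move=> p; apply: cvg_Re_Im; [exact: cvg_fst|exact: cvg_snd].
have sc : compact (m @` (`[- r, r]%classic `*` `[- r, r]%classic)).
  apply: continuous_compact; first exact: continuous_subspaceT.
  by apply: compact_setX; exact: segment_compact.
apply: (subclosed_compact _ sc).
  rewrite (_ : [set z | _] = (@modc R) @^-1` [set x | x <= r]); last by [].
  apply: closed_comp; last exact: closed_le.
  by move=> z _; exact: modc_continuous.
move=> z /= zr; exists (complex.Re z, complex.Im z); last by case: (z).
split=> /=; rewrite in_itv /= -ler_norml.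
- exact: le_trans (modc_ge_Re z) zr.
- exact: le_trans (modc_ge_Im z) zr.
Qed.

End Modulus.

(** * Power series at the origin *)

Section PowerSeries.
Variable R : realType.
Local Notation C := (Cplx R).
Local Notation "r %:C" := (real_complex R r : C).
Implicit Types (z w h u : C) (r : R) (f g : C -> C) (c d : nat -> C).

(** The summation principle behind all power series below. Completeness of
    the plane is inherited from [R] through real and imaginary parts, and
    the tail estimate is what turns a power series into a Taylor expansion
    with remainder. *)
Lemma cvg_geom_dominated (a : nat -> C) (K q : R) :
    0 <= q < 1 -> (forall k, modc (a k) <= K * q ^+ k) ->
  exists2 l : C, series a @ \oo --> l &
    forall n, modc (l - series a n) <= K * q ^+ n / (1 - q).
Proof.
move=> /andP[q0 q1] aK.
have K0 : 0 <= K.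
  by have := aK 0; rewrite mulr1; apply: le_trans; exact: modc_ge0.
have q1' : 0 < 1 - q by rewrite subr_gt0.
have cvp (p : nat -> R) : (forall k, `|p k| <= K * q ^+ k) -> cvgn (series p).
  move=> pK; apply: normed_cvg.
  apply: (@series_le_cvg _ (fun k => `|p k|) (geometric K q)) => //.
  - by move=> k; rewrite /= mulr_ge0 ?exprn_ge0.
  - by apply: is_cvg_geometric_series; rewrite ger0_norm.
have re k : `|complex.Re (a k)| <= K * q ^+ k.
  exact: le_trans (modc_ge_Re _) (aK k).
have im k : `|complex.Im (a k)| <= K * q ^+ k.
  exact: le_trans (modc_ge_Im _) (aK k).
have cre := cvp _ re; have cim := cvp _ im.
pose l : C := (lim (series (fun k => complex.Re (a k)) @ \oo)
    +i* lim (series (fun k => complex.Im (a k)) @ \oo))%C.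
have al : series a @ \oo --> l.
  apply: cvg_Re_Im => //=.
  - rewrite (_ : (fun n => _) = series (fun k => complex.Re (a k))) //.
    by apply/funext => n; rewrite /series /= Re_sum.
  - rewrite (_ : (fun n => _) = series (fun k => complex.Im (a k))) //.
    by apply/funext => n; rewrite /series /= Im_sum.
exists l => // n.
apply: (modc_lim_le al); near=> m.
have nm : (n <= m)%N by near: m; exact: nbhs_infty_ge.
rewrite sub_series_geq //.
apply: (le_trans (modc_sum _ _ _)).
apply: (@le_trans _ _ (\sum_(n <= k < m) K * q ^+ k)); first exact: ler_sum.
rewrite ler_pdivlMr // -mulr_sumr -mulrA ler_wpM2l //.
rewrite mulr_suml (eq_bigr (fun k => - (q ^+ k.+1 - q ^+ k))); last first.
  by move=> k _; rewrite exprSr; ring.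
by rewrite sumrN telescope_sumr // opprB lerBlDr lerDl exprn_ge0.
Unshelve. all: by end_near. Qed.

(** The bound on the coefficients makes the series geometrically dominated
    on every smaller disk, so each closure property reduces to an estimate
    on coefficients together with linearity of limits. *)
Definition has_ps r f c : Prop :=
  [/\ 0 < r, exists M, forall k, modc (c k) * r ^+ k <= M &
  forall h, modc h < r -> series (fun k => c k * h ^+ k) @ \oo --> f h].

Lemma eq_has_ps r f g c :
  (forall h, modc h < r -> f h = g h) -> has_ps r f c -> has_ps r g c.
Proof.
move=> fg [r0 cM cf]; split=> [||h hr]; [exact: r0|exact: cM|].
by rewrite -(fg h hr); exact: cf.
Qed.

Lemma has_psW r s f c : 0 < s <= r -> has_ps r f c -> has_ps s f c.
Proof.
move=> /andP[s0 sr] [r0 [M cM] cf]; split=> [||h hs]; first exact: s0.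
- exists M => k; apply: le_trans (cM k); rewrite ler_wpM2l ?modc_ge0 //.
  by rewrite lerXn2r // nnegrE ltW.
- by apply: cf; apply: lt_le_trans sr.
Qed.

Lemma bounded_has_ps r c M : 0 < r ->
  (forall k, modc (c k) * r ^+ k <= M) -> exists f, has_ps r f c.
Proof.
move=> r0 cM.
have /choice[f fP] : forall h, exists l : C, modc h < r ->
    series (fun k => c k * h ^+ k) @ \oo --> l.
  move=> h; have [rh|hr] := leP r (modc h).
    by exists 0.
  have [||l cl _] := @cvg_geom_dominated (fun k => c k * h ^+ k) M
      (modc h / r).
  - by rewrite divr_ge0 ?modc_ge0 ?(ltW r0) // ltr_pdivrMr ?mul1r // hr.
  - move=> k; rewrite modcM modcX expr_div_n mulrA.
    by rewrite ler_pdivlMr ?exprn_gt0 // mulrAC ler_wpM2r ?exprn_ge0 ?modc_ge0.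
  by exists l => _; exact: cl.
by exists f; split=> [||h]; [exact: r0|exists M|exact: fP].
Qed.

Lemma has_ps_remainder r f c : has_ps r f c ->
  exists2 M, 0 <= M & forall n h, modc h < r ->
    modc (f h - \sum_(0 <= k < n) c k * h ^+ k)
      <= M * (modc h / r) ^+ n / (1 - modc h / r).
Proof.
move=> [r0 [M cM] cf]; exists M => [|n h hr].
  by apply: le_trans (cM 0); rewrite mulr_ge0 ?modc_ge0.
have [||l cl /(_ n)] := @cvg_geom_dominated (fun k => c k * h ^+ k) M
      (modc h / r).
- by rewrite divr_ge0 ?modc_ge0 ?(ltW r0) // ltr_pdivrMr ?mul1r // hr.
- move=> k; rewrite modcM modcX expr_div_n mulrA.
  by rewrite ler_pdivlMr ?exprn_gt0 // mulrAC ler_wpM2r ?exprn_ge0 ?modc_ge0.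
by rewrite (cvg_unique _ cl (cf h hr)).
Qed.

Lemma has_ps_at0 r f c : has_ps r f c -> f 0 = c 0.
Proof.
move=> fc; have [r0 _ _] := fc.
have [M M0 /(_ 1 0)] := has_ps_remainder fc.
rewrite modc0 => /(_ r0); rewrite big_nat1 mulr1 mul0r expr1 mulr0 mul0r => h.
by apply/eqP; rewrite -subr_eq0 -modc_eq0 eq_le h modc_ge0.
Qed.

Lemma has_ps_unique r f g c : has_ps r f c -> has_ps r g c ->
  forall h, modc h < r -> f h = g h.
Proof.
move=> [_ _ cf] [_ _ cg] h hr.
exact: (cvg_unique (@norm_hausdorff _ _) (cf h hr) (cg h hr)).
Qed.

Lemma has_ps_cst r a : 0 < r -> has_ps r (fun=> a) (fun k => a *+ (k == 0)).
Proof.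
move=> r0; split=> [||h _]; first exact: r0.
  exists (modc a) => -[|k]; first by rewrite mulr1.
  by rewrite mulr0n modc0 mul0r modc_ge0.
apply/cvg_modcP => e e0; near=> n.
have n0 : (0 < n)%N by near: n; exact: nbhs_infty_gt.
rewrite /series /= big_ltn // big1_seq; last first.
  by move=> [|i]; rewrite ?mem_index_iota //= mulr0n mul0r.
by rewrite mulr1n mulr1 addr0 subrr modc0.
Unshelve. all: by end_near. Qed.

Lemma has_psD r f g c d : has_ps r f c -> has_ps r g d ->
  has_ps r (fun h => f h + g h) (fun k => c k + d k).
Proof.
move=> [r0 [M cM] cf] [_ [M' dM] dg]; split=> [||h hr]; first exact: r0.
  exists (M + M') => k.
  apply: (@le_trans _ _ ((modc (c k) + modc (d k)) * r ^+ k)).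
    by rewrite ler_wpM2r ?modcD // exprn_ge0 // ltW.
  by rewrite mulrDl lerD.
rewrite (_ : (fun k => _) =
    (fun k => c k * h ^+ k) + (fun k => d k * h ^+ k)); last first.
  by apply/funext => k; rewrite mulrDl.
by rewrite seriesD; apply: cvgD; [exact: cf|exact: dg].
Qed.

Lemma has_psZ r f c a : has_ps r f c ->
  has_ps r (fun h => a * f h) (fun k => a * c k).
Proof.
move=> [r0 [M cM] cf]; split=> [||h hr]; first exact: r0.
  by exists (modc a * M) => k; rewrite modcM -mulrA ler_wpM2l ?modc_ge0.
rewrite (_ : (fun k => _) = a *: (fun k => c k * h ^+ k)).
  by rewrite seriesZ; apply: cvgZr; exact: cf.
by apply/funext => k; rewrite -mulrA.
Qed.

Lemma has_ps_sum (I : Type) (l : seq I) r (F : I -> C -> C)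
    (a : I -> nat -> C) :
  0 < r -> (forall i, has_ps r (F i) (a i)) ->
  has_ps r (fun h => \sum_(i <- l) F i h) (fun k => \sum_(i <- l) a i k).
Proof.
move=> r0 Fa; elim: l => [|i l IH].
  rewrite (_ : (fun k : nat => _) = (fun k => (0 : C) *+ (k == 0%N))).
    by apply: eq_has_ps (has_ps_cst 0 r0) => h _; rewrite big_nil.
  by apply/funext => k; rewrite big_nil mul0rn.
rewrite (_ : (fun k : nat => _) = (fun k => a i k + \sum_(j <- l) a j k)).
  by apply: eq_has_ps (has_psD (Fa i) IH) => h _; rewrite big_cons.
by apply/funext => k; rewrite big_cons.
Qed.

Lemma has_psMX r f c : has_ps r f c ->
  has_ps r (fun h => h * f h) (fun k => if k is k'.+1 then c k' else 0).
Proof.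
move=> [r0 [M cM] cf]; split=> [||h hr]; first exact: r0.
  have M0 : 0 <= M by apply: le_trans (cM 0); rewrite mulr_ge0 ?modc_ge0.
  exists (r * M) => -[|k]; first by rewrite modc0 mul0r mulr_ge0 // ltW.
  by rewrite exprS mulrCA ler_wpM2l // ltW.
rewrite -cvg_shiftS.
rewrite (_ : (fun n => _) = h *: series (fun k => c k * h ^+ k)).
  by apply: cvgZr; exact: cf.
apply/funext => n; rewrite /series /= big_nat_recl // mul0r add0r.
rewrite [RHS]mulr_sumr; apply: eq_bigr => k _; rewrite exprS.
by rewrite mulrCA.
Qed.

Lemma has_ps_rot r f c w : modc w = 1 -> has_ps r f c ->
  has_ps r (fun h => f (w * h)) (fun k => c k * w ^+ k).
Proof.
move=> w1 [r0 [M cM] cf]; split=> [||h hr]; first exact: r0.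
  by exists M => k; rewrite modcM modcX w1 expr1n mulr1.
rewrite (_ : (fun k => _) = (fun k => c k * (w * h) ^+ k)).
  by apply: cf; rewrite modcM w1 mul1r.
by apply/funext => k; rewrite exprMn mulrA.
Qed.

Lemma has_ps_geometric r z : 0 < r -> modc z * r < 1 ->
  has_ps r (fun u => (1 - z * u)^-1) (fun m => z ^+ m).
Proof.
move=> r0 zr.
have zM k : modc (z ^+ k) * r ^+ k <= 1.
  by rewrite modcX -exprMn exprn_ile1 ?mulr_ge0 ?modc_ge0 ?ltW.
have [D Dz] := bounded_has_ps r0 zM.
apply: (eq_has_ps _ Dz) => h hr.
have h0 : 1 - z * h != 0.
  apply: one_sub_neq0; apply: le_lt_trans zr.
  by rewrite ler_wpM2l ?modc_ge0 // ltW.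
have H1 := has_psD Dz (has_psZ (- z) (has_psMX Dz)).
have H2 := has_ps_cst 1 r0.
rewrite (_ : (fun k : nat => _ + _) = (fun k => (1 : C) *+ (k == 0%N))) in H1.
  have /= E := has_ps_unique H1 H2 hr.
  apply: (mulfI h0); rewrite divff //; apply: etrans E; ring.
by apply/funext => -[|k] /=; rewrite ?mulr0 ?addr0 // exprS mulNr subrr.
Qed.

(** Removing the first [n] terms divides by [h ^ n], which settles the value
    of the quotient everywhere except at [0], where it has to be the
    coefficient of index [n]. *)
Lemma has_ps_drop n r f g c : has_ps r f c ->
  (forall h, modc h < r -> h != 0 ->
     f h = \sum_(0 <= k < n) c k * h ^+ k + h ^+ n * g h) ->
  g 0 = c n -> has_ps r g (fun k => c (k + n)).
Proof.
move=> [r0 [M cM] cf] fg g0; split=> [||h hr]; first exact: r0.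
  exists (M / r ^+ n) => k; rewrite ler_pdivlMr ?exprn_gt0 // -mulrA -exprD.
  exact: cM.
have [->|h0] := eqVneq h 0.
  rewrite g0; have [_ _ /(_ 0)] := has_ps_cst (c n) r0.
  rewrite modc0 => /(_ r0).
  rewrite (_ : (fun k => _) = (fun k => c (k + n)%N * 0 ^+ k)); first by [].
  apply/funext => -[|k]; first by rewrite mulr1n !expr0 add0n.
  by rewrite !expr0n /= !mulr0.
have hn0 : h ^+ n != 0 by rewrite expf_neq0.
rewrite (_ : g h = h ^- n * (f h - \sum_(0 <= k < n) c k * h ^+ k)); last first.
  by rewrite fg // [X in X - _]addrC addrK mulKf.
rewrite (_ : series _ = h ^- n *:
  (fun N => series (fun k => c k * h ^+ k) (N + n)%N
     - \sum_(0 <= k < n) c k * h ^+ k)).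
  apply: cvgZr; apply: cvgB; last exact: cvg_cst.
  by rewrite cvg_shiftn; exact: cf.
apply/funext => m; rewrite [RHS]/GRing.scale /= /series /=.
rewrite (@big_cat_nat _ _ _ n _ (m + n)) ?leq_addl //=.
rewrite [X in _ = _ * X]addrAC subrr add0r.
rewrite (_ : \sum_(n <= k < m + n) c k * h ^+ k =
    \sum_(0 <= k < m) c (k + n)%N * h ^+ (k + n)); last first.
  by rewrite -{1}(add0n n) big_addn addnK.
rewrite mulr_sumr; apply: eq_bigr => k _.
by rewrite exprD; move: (h ^+ n) hn0 => x x0; field.
Qed.

(** Dividing by [1 - mu * h] leads to the recurrence
    [d k.+1 = c k.+1 + mu * d k]; when [modc mu * r < 1] its solution stays
    bounded at radius [r] by a geometric series. This replaces Cauchy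
    products: every rational function below is built from affine factors and
    inverses of affine factors. *)
Lemma has_ps_div r f g c mu : modc mu * r < 1 -> has_ps r f c ->
  (forall h, modc h < r -> (1 - mu * h) * g h = f h) ->
  exists d, has_ps r g d.
Proof.
move=> mur [r0 [M cM] cf] fg.
pose d := fix d k := c k + (if k is k'.+1 then mu * d k' else 0).
have M0 : 0 <= M by apply: le_trans (cM 0); rewrite mulr_ge0 ?modc_ge0.
have q0 : 0 < 1 - modc mu * r by rewrite subr_gt0.
(* M / (1 - modc mu * r) is the fixed point of x |-> M + modc mu * r * x. *)
have dM k : modc (d k) * r ^+ k <= M / (1 - modc mu * r).
  elim: k => [|k IH] /=.
    rewrite addr0; apply: (le_trans (cM 0)).
    rewrite ler_pdivlMr // ler_piMr // lerBlDr lerDl.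
    by rewrite mulr_ge0 ?modc_ge0 // ltW.
  apply: (@le_trans _ _ (modc (c k.+1) * r ^+ k.+1 +
     modc mu * r * (modc (d k) * r ^+ k))).
    rewrite (_ : modc mu * r * _ = modc (mu * d k) * r ^+ k.+1); last first.
      by rewrite exprS modcM; ring.
    by rewrite -mulrDl ler_wpM2r ?modcD // exprn_ge0 // ltW.
  apply: (@le_trans _ _ (M + modc mu * r * (M / (1 - modc mu * r)))).
    by apply: lerD => //; rewrite ler_wpM2l // mulr_ge0 ?modc_ge0 // ltW.
  rewrite le_eqVlt (_ : _ + _ = M / (1 - modc mu * r)) ?eqxx //.
  by field; rewrite gt_eqF.
have [D Dd] := bounded_has_ps r0 dM.
exists d; apply: (eq_has_ps _ Dd) => h hr.
have h1 : 1 - mu * h != 0.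
  apply/eqP => /subr0_eq h1; have := modc1 R; rewrite h1 modcM => h2.
  suff : modc mu * modc h < 1 by rewrite h2 ltxx.
  by apply: le_lt_trans mur; rewrite ler_wpM2l ?modc_ge0 // ltW.
apply: (mulfI h1); rewrite fg //.
have [_ _ /(_ h hr) E] := has_psD Dd (has_psZ (- mu) (has_psMX Dd)).
rewrite [LHS](_ : _ = D h + - mu * (h * D h)); last by ring.
apply: (cvg_unique (@norm_hausdorff _ _) E).
rewrite /= (_ : (fun k => _) = (fun k => c k * h ^+ k)); first exact: cf.
apply/funext => -[|k] /=; first by rewrite mulr0 !addr0.
by congr (_ * _); ring.
Qed.

End PowerSeries.

(** * Analytic functions *)

Section Analytic.
Variable R : realType.
Local Notation C := (Cplx R).
Local Notation "r %:C" := (real_complex R r : C).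
Implicit Types (z w h u : C) (r : R) (f g : C -> C) (c d : nat -> C).

(** A convergent series has bounded terms, so convergence on a small disk
    already gives the coefficient bound at half the radius. *)
Lemma analytic_atP f z0 :
  analytic_at f z0 <-> exists r c, has_ps r (fun h => f (z0 + h)) c.
Proof.
split=> [[c /nbhs_modcP[r r0 cf]]|[r [c [r0 _ cf]]]]; last first.
  exists c; apply/nbhs_modcP; exists r => [|h hr]; first exact: r0.
  by rewrite [z0 + h - z0]addrAC subrr add0r; exact: cf.
have r20 : 0 < r / 2 by rewrite divr_gt0.
have r2r : r / 2 < r by rewrite ltr_pdivrMr // ltr_pMr // ltr1n.
exists (r / 2), c; split=> [||h hr]; first exact: r20.
  have s0 : modc (r / 2)%:C = r / 2 by rewrite modc_real gtr0_norm.
  have sr : modc (r / 2)%:C < r by rewrite s0.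
  have cs : cvgn (series (fun k => c k * (z0 + (r / 2)%:C - z0) ^+ k)).
    by apply/cvg_ex; exists (f (z0 + (r / 2)%:C)); exact: cf.
  have /cvg_modcP /(_ 1 ltr01)[n _ hn] := cvg_series_cvg_0 cs.
  exists (1 + \sum_(0 <= k < n) modc (c k) * (r / 2) ^+ k) => k.
  have S0 : 0 <= \sum_(0 <= k < n) modc (c k) * (r / 2) ^+ k.
    by apply: sumr_ge0 => i _; rewrite mulr_ge0 ?modc_ge0 // exprn_ge0 // ltW.
  have [nk|kn] := leqP n k.
    have /= := hn _ nk.
    rewrite sub0r modcN [X in X ^+ k]addrAC subrr add0r modcM modcX s0.
    by move=> /ltW h1; apply: (le_trans h1); rewrite lerDl.
  rewrite (bigD1_seq k) ?mem_index_iota ?iota_uniq //= addrCA lerDl addr_ge0 //.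
  by apply: sumr_ge0 => i _; rewrite mulr_ge0 ?modc_ge0 // exprn_ge0 // ltW.
have := cf h (lt_trans hr r2r).
by rewrite [z0 + h - z0]addrAC subrr add0r.
Qed.

Lemma near_eq_analytic_at f g z0 :
  (\forall z \near z0, f z = g z) -> analytic_at f z0 -> analytic_at g z0.
Proof.
move=> fg [c cf]; exists c; apply: filterS2 fg cf => z <-; exact.
Qed.

Lemma eq_analytic_at f g z0 : f =1 g -> analytic_at f z0 -> analytic_at g z0.
Proof. by move=> /funext ->. Qed.

Lemma analytic_at_cst a z0 : analytic_at (fun=> a : C) z0.
Proof.
by apply/analytic_atP; exists 1, (fun k => a *+ (k == 0)); exact: has_ps_cst.
Qed.

Lemma analytic_atD f g z0 : analytic_at f z0 -> analytic_at g z0 ->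
  analytic_at (fun z => f z + g z) z0.
Proof.
move=> /analytic_atP[r [c fc]] /analytic_atP[s [d gd]]; apply/analytic_atP.
have [[r0 _ _] [s0 _ _]] := (fc, gd).
have m0 : 0 < Num.min r s by rewrite lt_min r0 s0.
exists (Num.min r s), (fun k => c k + d k); apply: has_psD.
- by apply: has_psW fc; rewrite m0 ge_min lexx.
- by apply: has_psW gd; rewrite m0 ge_min lexx orbT.
Qed.

Lemma analytic_atZ a f z0 :
  analytic_at f z0 -> analytic_at (fun z => a * f z) z0.
Proof.
move=> /analytic_atP[r [c fc]]; apply/analytic_atP.
by exists r, (fun k => a * c k); exact: has_psZ.
Qed.

Lemma analytic_at_sum (I : Type) (r : seq I) (P : pred I) (F : I -> C -> C) z0 :
  (forall i, P i -> analytic_at (F i) z0) ->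
  analytic_at (fun z => \sum_(i <- r | P i) F i z) z0.
Proof.
move=> aF; elim: r => [|i r IH].
  by apply: eq_analytic_at (analytic_at_cst 0 z0) => z; rewrite big_nil.
have [Pi|Pi] := boolP (P i); last first.
  by apply: eq_analytic_at IH => z; rewrite big_cons (negbTE Pi).
by apply: eq_analytic_at (analytic_atD (aF i Pi) IH) => z; rewrite big_cons Pi.
Qed.

Lemma analytic_at_mul_affine a b f z0 : analytic_at f z0 ->
  analytic_at (fun z => (a + b * z) * f z) z0.
Proof.
move=> /analytic_atP[r [c fc]]; apply/analytic_atP; exists r.
have := has_psD (has_psZ (a + b * z0) fc) (has_psZ b (has_psMX fc)).
by move=> H; eexists; apply: eq_has_ps H => h _; ring.
Qed.

(** Around [z0] the denominator is [(a + b * z0) * (1 - mu * h)] with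
    [mu = - b / (a + b * z0)], and the radius can be shrunk until
    [modc mu * s < 1]. *)
Lemma analytic_at_div_affine a b f z0 : a + b * z0 != 0 -> analytic_at f z0 ->
  analytic_at (fun z => f z / (a + b * z)) z0.
Proof.
set d := a + b * z0 => d0 /analytic_atP[r [c fc]]; apply/analytic_atP.
have [r0 _ _] := fc.
pose mu := - b / d.
have m1 : 0 < 1 + modc mu by rewrite ltr_wpDr // modc_ge0.
pose s := r / (1 + r * (1 + modc mu)).
have D0 : 0 < 1 + r * (1 + modc mu) by rewrite ltr_wpDr // mulr_ge0 // ltW.
have s0 : 0 < s by rewrite divr_gt0.
have sr : s <= r.
  by rewrite ler_pdivrMr // ler_peMr ?(ltW r0) // lerDl mulr_ge0 // ltW.
have mus : modc mu * s < 1.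
  rewrite mulrA ltr_pdivrMr // mul1r.
  have := modc_ge0 mu; nra.
have fs : has_ps s (fun h => f (z0 + h)) c by apply: has_psW fc; rewrite s0.
have [||e he] := @has_ps_div _ s (fun h => d^-1 * f (z0 + h))
   (fun h => f (z0 + h) / (a + b * (z0 + h))) _ mu _ (has_psZ d^-1 fs).
- exact: mus.
- move=> h hs.
  have h0 : 1 - mu * h != 0.
    apply/eqP => /subr0_eq h1; have := modc1 R; rewrite h1 modcM => h2.
    suff : modc mu * modc h < 1 by rewrite h2 ltxx.
    by apply: le_lt_trans mus; rewrite ler_wpM2l ?modc_ge0 // ltW.
  rewrite (_ : a + b * (z0 + h) = d * (1 - mu * h)); last first.
    by rewrite /mu mulrBr mulr1 mulrA mulrCA divff // mulr1 /d; ring.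
  by field; rewrite d0 h0.
- by exists s, e.
Qed.

Lemma analytic_at_rot w f z0 : modc w = 1 -> analytic_at f (w * z0) ->
  analytic_at (fun z => f (w * z)) z0.
Proof.
move=> w1 /analytic_atP[r [c fc]]; apply/analytic_atP.
exists r, (fun k => c k * w ^+ k); apply: eq_has_ps (has_ps_rot w1 fc) => h _.
by rewrite mulrDr.
Qed.

Lemma analytic_at_continuous f z0 : analytic_at f z0 -> {for z0, continuous f}.
Proof.
move=> /analytic_atP[r [c fc]].
apply: (proj2 (@cvg_modcP R C (nbhs z0) _ f (f z0))) => e e0.
have [r0 _ _] := fc; have [M M0 hM] := has_ps_remainder fc.
have fz : f z0 = c 0 by rewrite -(has_ps_at0 fc) addr0.
pose s := Num.min (r / 2) (e * r / (2 * M + 1)).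
have M1 : 0 < 2 * M + 1 by rewrite ltr_wpDl ?mulr_ge0.
have s0 : 0 < s by rewrite lt_min !divr_gt0 // mulr_gt0.
apply/nbhs_modcP; exists s => [|h]; first exact: s0.
rewrite lt_min => /andP[hr he].
have hr' : modc h < r.
  apply: lt_le_trans hr _.
  by rewrite ler_pdivrMr // ler_peMr ?ler1n // ltW.
have := hM 1 h hr'; rewrite big_nat1 mulr1 -fz expr1 modc_distC => H.
apply: (le_lt_trans H).
have hr2 : modc h / r < 1 / 2 by rewrite ltr_pdivrMr // mulrC mulrA mulr1.
have hre : modc h / r * (2 * M + 1) < e.
  by move: he; rewrite ltr_pdivlMr // mulrAC ltr_pdivrMr.
have : 0 <= modc h / r by rewrite divr_ge0 ?modc_ge0 // ltW.
move: (modc h / r) hr2 hre => x hr2 hre x0.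
rewrite ltr_pdivrMr; last by lra.
by nra.
Qed.

(** The terms of degree 1, 2 and 3 cancel when summed over the four points
    [a + i ^ j s], so only an error of order four is left, negligible
    against the increment of order two with which [maximum_modulus] compares
    it. *)
Lemma analytic_at_four_points f a : analytic_at f a ->
  exists K s0, [/\ 0 <= K, 0 < s0 & forall s : R, 0 < s < s0 ->
    modc (f (a + s%:C) + f (a - s%:C) + f (a + 'i%C * s%:C)
            + f (a - 'i%C * s%:C) - 4 * f a) <= K * s ^+ 4].
Proof.
move=> /analytic_atP[r [c fc]]; have [r0 _ _] := fc.
have [M M0 hM] := has_ps_remainder fc.
have fa : f a = c 0 by rewrite -(has_ps_at0 fc) addr0.
(* For s < r / 2 the remainder M (s/r)^4 / (1 - s/r) is at most 2 M (s/r)^4;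
   there are four of them. *)
exists (8 * M / r ^+ 4), (r / 2); split.
- by rewrite divr_ge0 ?mulr_ge0 ?exprn_ge0 // ltW.
- by rewrite divr_gt0.
move=> s /andP[s0 sr].
have i1 : modc ('i%C : C) = 1 by rewrite /modc /= expr0n /= expr1n add0r sqrtr1.
have i2 : ('i%C : C) ^+ 2 = -1 by exact: sqr_i.
pose e h := f (a + h) - \sum_(0 <= k < 4) c k * h ^+ k.
have eM h : modc h = s -> modc (e h) <= 2 * M / r ^+ 4 * s ^+ 4.
  move=> hs; have hr : modc h < r.
    by rewrite hs (lt_trans sr) // ltr_pdivrMr // ltr_pMr // ltr1n.
  apply: (le_trans (hM 4 h hr)); rewrite hs.
  have sr1 : s / r <= 1 / 2.
    by rewrite ler_pdivrMr // mulrC mulrA mulr1 ltW.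
  rewrite ler_pdivrMr; last by lra.
  rewrite expr_div_n.
  rewrite (_ : 2 * M / _ * _ * _ = M * (s ^+ 4 / r ^+ 4) * (2 * (1 - s / r)));
    last by ring.
  rewrite ler_peMr ?mulr_ge0 ?invr_ge0 ?exprn_ge0 ?(ltW s0) ?(ltW r0) //.
  by lra.
have key (t S x y u v : C) : t ^+ 2 = -1 -> x + y + u + v - 4 * c 0 =
    (x - \sum_(0 <= k < 4) c k * S ^+ k)
    + (y - \sum_(0 <= k < 4) c k * (- S) ^+ k)
    + (u - \sum_(0 <= k < 4) c k * (t * S) ^+ k)
    + (v - \sum_(0 <= k < 4) c k * (- (t * S)) ^+ k).
  have sum4 (F : nat -> C) : \sum_(0 <= k < 4) F k = F 0 + F 1 + F 2 + F 3.
    by rewrite /index_iota unlock /= addr0 !addrA.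
  rewrite !sum4 => t2.
  have -> : (t * S) ^+ 2 = - S ^+ 2 by rewrite exprMn t2 mulN1r.
  have -> : (- (t * S)) ^+ 2 = - S ^+ 2 by rewrite sqrrN exprMn t2 mulN1r.
  ring.
have ms : modc s%:C = s by rewrite modc_real gtr0_norm.
rewrite (_ : _ - _ = e s%:C + e (- s%:C) + e ('i%C * s%:C)
    + e (- ('i%C * s%:C))); last first.
  by rewrite /e -(key _ _ _ _ _ _ i2) -fa.
have e1 := eM s%:C ms.
have e2 : modc (e (- s%:C)) <= 2 * M / r ^+ 4 * s ^+ 4.
  by apply: eM; rewrite modcN.
have e3 : modc (e ('i%C * s%:C)) <= 2 * M / r ^+ 4 * s ^+ 4.
  by apply: eM; rewrite modcM i1 mul1r.
have e4 : modc (e (- ('i%C * s%:C))) <= 2 * M / r ^+ 4 * s ^+ 4.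
  by apply: eM; rewrite modcN modcM i1 mul1r.
rewrite (_ : 8 * M / r ^+ 4 * s ^+ 4 =
  2 * M / r ^+ 4 * s ^+ 4 + 2 * M / r ^+ 4 * s ^+ 4
  + 2 * M / r ^+ 4 * s ^+ 4 + 2 * M / r ^+ 4 * s ^+ 4); last by ring.
apply: (le_trans (modcD _ _)); apply: lerD; last exact: e4.
apply: (le_trans (modcD _ _)); apply: lerD; last exact: e3.
by apply: (le_trans (modcD _ _)); apply: lerD; [exact: e1|exact: e2].
Qed.

End Analytic.

(** * Maximum modulus principle and Cauchy estimates *)

Section MaximumModulus.
Variable R : realType.
Local Notation C := (Cplx R).
Local Notation "r %:C" := (real_complex R r : C).
Implicit Types (z w h u : C) (r : R) (f g : C -> C) (c d : nat -> C).

(** Suppose that [g z = modc (f z) + e * modc z ^+ 2] were maximal at an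
    interior point [a]. Over the four points [a + i ^ j s] the average of
    the second term exceeds its value at [a] by exactly [e * s ^+ 2], while
    the average of [modc (f z)] falls below [modc (f a)] by at most a
    multiple of [s ^+ 4]. For small [s] some [g] would then be larger than
    [g a]. So the maximum is on the circle, and [e] tends to [0]. *)
Lemma maximum_modulus r f (M : R) :
  (forall z, modc z <= r -> analytic_at f z) ->
  (forall z, modc z = r -> modc (f z) <= M) ->
  forall z, modc z <= r -> modc (f z) <= M.
Proof.
move=> af fM z zr.
have r0 : 0 <= r by apply: le_trans zr; exact: modc_ge0.
suff H (e : R) : 0 < e -> modc (f z) <= M + e * r ^+ 2.
  apply/ler_addgt0Pr => e e0.
  have r1 : 0 < r ^+ 2 + 1 by rewrite ltr_wpDl ?sqr_ge0.
  have := H (e / (r ^+ 2 + 1)); rewrite divr_gt0 // => /(_ isT) h.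
  apply: (le_trans h); rewrite lerD2l mulrAC ler_pdivrMr // ler_pM2l //.
  by rewrite lerDl.
move=> e0; pose g z := modc (f z) + e * modc z ^+ 2.
have gc : {within [set z : C | modc z <= r], continuous g}.
  apply: continuous_in_subspaceT => x; rewrite inE /= => xr.
  have c1 := continuous_modc (analytic_at_continuous (af x xr)).
  have c2 := @modc_continuous R x.
  exact: (cvgD c1 (cvgM (cvg_cst e) (cvgM c2 c2))).
have [a ar ga] : exists2 a : C, modc a <= r &
    forall x : C, modc x <= r -> g x <= g a.
  have [a + ga] := compact_EVT_max (ex_intro _ z zr) (@compact_modc_le R r) gc.
  by rewrite inE => ar; exists a => // x xr; apply: ga; rewrite inE.
have gz := ga z zr.
suff ga' : g a <= M + e * r ^+ 2.
  apply: le_trans (le_trans gz ga'); rewrite /g lerDl.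
  by apply: mulr_ge0; [exact: ltW|exact: sqr_ge0].
have [are|ane] := eqVneq (modc a) r.
  by rewrite /g are lerD2r fM.
exfalso.
have ar' : modc a < r by rewrite lt_neqAle ane.
have [K [s0 [K0 s00 hK]]] := analytic_at_four_points (af a ar).
have K1 : 0 < K + 1 by rewrite ltr_wpDl.
(* s is small enough for the four points to stay in the disk and, being at most
   1 and 2 e / (K + 1), for K s^4 to be smaller than 4 e s^2. *)
pose s := Num.min (Num.min (s0 / 2) (r - modc a)) (Num.min 1 (2 * e / (K + 1))).
have s_gt0 : 0 < s.
  by rewrite !lt_min !divr_gt0 ?subr_gt0 ?ltr01 ?mulr_gt0 // ar'.
have ss0 : s < s0.
  have : s <= s0 / 2 by rewrite !ge_min lexx.
  by move=> h; apply: (le_lt_trans h); rewrite ltr_pdivrMr // ltr_pMr // ltr1n.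
have sr : modc a + s <= r.
  by rewrite -lerBrDl; rewrite !ge_min lexx orbT.
have s1 : s <= 1 by rewrite !ge_min lexx !orbT.
have se : s * (K + 1) <= 2 * e.
  by rewrite -ler_pdivlMr // !ge_min lexx !orbT.
have ms : modc s%:C = s by rewrite modc_real gtr0_norm.
have i1 : modc ('i%C : C) = 1 by rewrite /modc /= expr0n /= expr1n add0r sqrtr1.
have mis : modc ('i%C * s%:C) = s by rewrite modcM i1 mul1r.
have G h : modc h = s -> modc (f (a + h)) + e * modc (a + h) ^+ 2 <= g a.
  move=> hs; apply: (ga (a + h)).
  by apply: (le_trans (modcD _ _)); rewrite hs.
have g1 := G _ ms; have g2 := G (- s%:C); rewrite modcN in g2.
have {}g2 := g2 ms.
have g3 := G _ mis; have g4 := G (- ('i%C * s%:C)); rewrite modcN in g4.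
have {}g4 := g4 mis.
have p1 := modc_parallelogram a s%:C; rewrite ms in p1.
have p2 := modc_parallelogram a ('i%C * s%:C); rewrite mis in p2.
have ss : 0 < s < s0 by rewrite s_gt0.
have := hK s ss.
set x := f (a + s%:C) in g1 *; set y := f (a - s%:C) in g2 *.
set u := f (a + _) in g3 *; set v := f (a - _) in g4 *.
move=> hk.
have h4 : 4 * modc (f a) <= modc x + modc y + modc u + modc v + K * s ^+ 4.
  have : modc (4 * f a) <=
      modc (x + y + u + v) + modc (x + y + u + v - 4 * f a).
    have := modcB (x + y + u + v) (x + y + u + v - 4 * f a).
    by rewrite opprB [X in modc X <= _]addrC subrK.
  rewrite modcM (_ : modc (4 : C) = 4); last exact: modc_nat.
  have t1 := modcD (x + y + u) v; have t2 := modcD (x + y) u.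
  have t3 := modcD x y.
  lra.
move: g1 g2 g3 g4; rewrite /g.
have : K * s ^+ 4 < 4 * e * s ^+ 2.
  rewrite (_ : 4 = 2 + 2)%N // exprD mulrA ltr_pM2r ?exprn_gt0 //.
  by nra.
nra.
Qed.

(** Iterated square roots of [-1] give an element whose order divides
    [2 ^ n.+1] but not [2 ^ n]. *)
Lemma exists_primitive_root n : exists w : C, (2 ^ n.+1).-primitive_root w.
Proof.
have [w wn] : exists w : C, w ^+ (2 ^ n) = -1.
  elim: n => [|n [w wn]]; first by exists (-1).
  by exists (sqrtC w); rewrite expnS exprM sqrtCK.
have w1 : w ^+ (2 ^ n.+1) = 1 by rewrite expnSr exprM wn sqrrN expr1n.
have [|m mw] := prim_order_exists _ w1; first by rewrite expn_gt0.
move=> /(dvdn_pfactor _ _ (isT : prime 2))[i + mi].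
rewrite leq_eqVlt => /predU1P[<-|]; first by exists w; rewrite -mi.
rewrite ltnS => i_n; exfalso.
have : w ^+ (2 ^ n) = 1.
  by rewrite -(subnKC i_n) expnD exprM -mi (prim_expr_order mw) expr1n.
by rewrite wn => /eqP; rewrite eq_sym -addr_eq0 -mulr2n pnatr_eq0.
Qed.

Lemma sum_powers_root_of_unity (N : nat) w : w ^+ N = 1 -> w != 1 ->
  \sum_(0 <= j < N) w ^+ j = 0.
Proof.
move=> wN w1; apply: (mulfI (x := w - 1)); first by rewrite subr_eq0.
by rewrite mulr0 big_mkord -subrX1 wN subrr.
Qed.

(** The quotient of [f] minus its Taylor polynomial by [z ^+ n] remains
    analytic, including at the removable singularity [0]. *)
Lemma divide_out_monomial n r f c : has_ps r f c -> exists g,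
  [/\ g 0 = c n,
      forall z, z != 0 -> f z = \sum_(0 <= k < n) c k * z ^+ k + z ^+ n * g z &
      forall z, analytic_at f z -> analytic_at g z].
Proof.
move=> fc.
pose g z :=
  if z == 0 then c n else (f z - \sum_(0 <= k < n) c k * z ^+ k) / z ^+ n.
have g0 : g 0 = c n by rewrite /g eqxx.
have gE z : z != 0 -> f z = \sum_(0 <= k < n) c k * z ^+ k + z ^+ n * g z.
  move=> z0; rewrite /g (negbTE z0) mulrC divfK ?expf_neq0 //.
  by rewrite addrC subrK.
exists g; split=> [||z fz]; [exact: g0|exact: gE|].
have [->|z0] := eqVneq z 0.
  apply/analytic_atP; exists r, (fun k => c (k + n)).
  apply: (@eq_has_ps _ _ g) => [h _|]; first by rewrite add0r.
  by apply: (has_ps_drop fc) g0 => h _; exact: gE.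
have aX m (F : C -> C) :
    analytic_at F z -> analytic_at (fun x => F x / x ^+ m) z.
  move=> aF; elim: m => [|m IH].
    by apply: eq_analytic_at aF => x; rewrite expr0 divr1.
  have z1 : 0 + 1 * z != 0 by rewrite add0r mul1r.
  apply: eq_analytic_at (analytic_at_div_affine z1 IH) => x.
  by rewrite add0r mul1r exprSr invfM mulrA.
have aM m (F : C -> C) :
    analytic_at F z -> analytic_at (fun x => x ^+ m * F x) z.
  move=> aF; elim: m => [|m IH].
    by apply: eq_analytic_at aF => x; rewrite expr0 mul1r.
  apply: eq_analytic_at (analytic_at_mul_affine 0 1 IH) => x.
  by rewrite add0r mul1r exprS mulrA.
have subE (u v : C) : u - v = u + -1 * v by rewrite mulN1r.
pose F x := f x + -1 * \sum_(0 <= k < n) c k * x ^+ k.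
apply: (near_eq_analytic_at _ (aX n F _)).
- apply/nbhs_modcP; exists (modc z) => [|h hz]; first by rewrite modc_gt0.
  rewrite /g; case: eqP => [zh|_].
    by move: hz; rewrite -(addr0_eq zh) modcN ltxx.
  exact: (congr1 (fun y => y / _) (esym (subE _ _))).
- apply: (analytic_atD fz); apply: analytic_atZ; apply: analytic_at_sum => k _.
  apply: analytic_atZ.
  by apply: eq_analytic_at (aM k _ (analytic_at_cst 1 z)) => x; rewrite mulr1.
Qed.

(** Average the rotated functions [f (w ^+ j * z)] with weights
    [w ^- (j * n)], where [w] is a primitive root of unity of order [N > n].
    The average is still bounded by [M] on the circle, it kills the
    coefficients of index below [n] and keeps the one of index [n]. After
    division by [z ^+ n] that coefficient is the value at [0], and the
    maximum modulus principle bounds it. *)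
Lemma cauchy_estimate r s f c (M : R) : 0 < r -> has_ps s f c ->
  (forall z, modc z <= r -> analytic_at f z) ->
  (forall z, modc z = r -> modc (f z) <= M) ->
  forall n, modc (c n) * r ^+ n <= M.
Proof.
move=> r0 fc af fM n.
have [s0 _ _] := fc.
have M0 : 0 <= M.
  by apply: le_trans (fM r%:C _); rewrite ?modc_ge0 ?modc_real ?ger0_norm ?ltW.
have [w wN] := exists_primitive_root n.
set N := (2 ^ n.+1)%N in wN.
have nN : (n < N)%N by apply: ltn_trans (ltnSn n) (ltn_expl _ _).
have N0 : (0 < N)%N by rewrite expn_gt0.
have w1 : modc w = 1.
  have /eqP := congr1 (@modc R) (prim_expr_order wN).
  by rewrite modcX modc1 pexpr_eq1 ?modc_ge0 // => /eqP.
have w0 : w != 0 by rewrite -modc_gt0 w1.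
pose F z := N%:R^-1 * \sum_(0 <= j < N) (w ^+ (j * n))^-1 * f (w ^+ j * z).
pose d m :=
  N%:R^-1 * \sum_(0 <= j < N) (w ^+ (j * n))^-1 * (c m * w ^+ (j * m)).
have fj j : has_ps s (fun h => f (w ^+ j * h)) (fun m => c m * w ^+ (j * m)).
  rewrite (_ : (fun m => _) = (fun m => c m * (w ^+ j) ^+ m)).
    by apply: has_ps_rot fc; rewrite modcX w1 expr1n.
  by apply/funext => k; rewrite exprM.
have Fd : has_ps s F d.
  have FS := has_ps_sum (index_iota 0 N) s0
    (fun j => has_psZ (w ^+ (j * n))^-1 (fj j)).
  exact: (has_psZ N%:R^-1 FS).
have dn : d n = c n.
  rewrite /d (eq_bigr (fun=> c n)) => [|j _].
    rewrite big_const_nat iter_addr_0 subn0 -[c n *+ N]mulr_natl mulKf //.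
    by rewrite pnatr_eq0 -lt0n.
  by rewrite mulrCA mulVf ?mulr1 // expf_neq0.
(* The weights sum to zero because n - m < N is not a multiple of N. *)
have dm m : (m < n)%N -> d m = 0.
  move=> mn; rewrite /d.
  rewrite (eq_bigr (fun j => c m * (w ^+ (n - m))^-1 ^+ j)) => [|j _].
    rewrite -mulr_sumr sum_powers_root_of_unity ?mulr0 //.
      by rewrite exprVn -exprM mulnC exprM (prim_expr_order wN) expr1n invr1.
    rewrite invr_eq1 -(prim_order_dvd wN) gtnNdvd ?subn_gt0 //.
    by apply: leq_ltn_trans nN; exact: leq_subr.
  have E : w ^+ (j * n) = w ^+ ((n - m) * j) * w ^+ (j * m).
    by rewrite -exprD [((n - m) * j)%N]mulnC -mulnDr subnK // ltnW.
  rewrite mulrCA E invfM -mulrA mulVf ?mulr1; last by rewrite expf_neq0.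
  by rewrite exprVn -exprM.
have [g [g0 gE ag]] := divide_out_monomial n Fd.
have FE z : z != 0 -> F z = z ^+ n * g z.
  move=> z0; rewrite gE // big1_seq ?add0r // => k.
  by rewrite mem_index_iota => /= kn; rewrite dm ?mul0r.
have aF z : modc z <= r -> analytic_at F z.
  move=> zr; apply: analytic_atZ; apply: analytic_at_sum => j _.
  apply: analytic_atZ; apply: analytic_at_rot; first by rewrite modcX w1 expr1n.
  by apply: af; rewrite modcM modcX w1 expr1n mul1r.
have FM z : modc z = r -> modc (F z) <= M.
  move=> zr; rewrite /F modcM modcV ler_pdivrMl.
    apply: (le_trans (modc_sum _ _ _)).
    apply: (@le_trans _ _ (\sum_(0 <= j < N) M)).
      apply: ler_sum => j _; rewrite modcM modcV modcX w1 expr1n invr1 mul1r.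
      by apply: fM; rewrite modcM modcX w1 expr1n mul1r.
    by rewrite sumr_const_nat subn0 modc_nat mulr_natl.
  by rewrite modc_gt0 pnatr_eq0 -lt0n.
rewrite -ler_pdivlMr ?exprn_gt0 // -dn -g0.
apply: (@maximum_modulus r g (M / r ^+ n)).
- by move=> z zr; apply/ag/aF.
- move=> z zr; rewrite ler_pdivlMr ?exprn_gt0 // -zr -modcX -modcM mulrC -FE.
    exact: FM.
  by rewrite -modc_gt0 zr.
- by rewrite modc0 ltW.
Qed.

Lemma sum_geometric_le (q : R) n :
  0 <= q < 1 -> \sum_(0 <= k < n) q ^+ k <= (1 - q)^-1.
Proof.
move=> /andP[q0 q1]; have q1' : 0 < 1 - q by rewrite subr_gt0.
rewrite -[leRHS]mul1r ler_pdivlMr // mulrC big_mkord.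
have := subrX1 q n; rewrite -[X in _ = X * _]opprB mulNr => /(congr1 -%R).
by rewrite opprK opprB => <-; rewrite lerBlDr lerDl exprn_ge0.
Qed.

(** Dividing by [z ^+ n] the difference between [f] and its Taylor
    polynomial and applying the maximum modulus principle on a circle of
    radius [t] shows that this difference is at most
    [K * (modc z / t) ^+ n], with [K] independent of [n] by the Cauchy
    estimates. *)
Lemma analytic_has_ps r s f c (M : R) : 0 < r -> has_ps s f c ->
  (forall z, modc z <= r -> analytic_at f z) ->
  (forall z, modc z = r -> modc (f z) <= M) -> has_ps r f c.
Proof.
move=> r0 fc af fM; have cM := cauchy_estimate r0 fc af fM.
split=> [||z zr]; [exact: r0|by exists M|].
have [->|z0] := eqVneq z 0.
  by have [s0 _] := fc; apply; rewrite modc0.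
(* On the circle of radius t < r the Cauchy estimates bound all Taylor
   polynomials by M / (1 - t / r), which makes K independent of n. *)
have [t zt tr] : exists2 t, modc z < t & t < r.
  by exists ((modc z + r) / 2); lra.
have t0 : 0 < t by apply: le_lt_trans zt; exact: modc_ge0.
have M0 : 0 <= M by apply: le_trans (cM 0); rewrite mulr_ge0 ?modc_ge0.
have tr1 : 0 <= t / r < 1 by rewrite divr_ge0 ?ltW //= ltr_pdivrMr // mul1r.
pose K := M + M / (1 - t / r).
have main n :
    modc (f z - \sum_(0 <= k < n) c k * z ^+ k) <= K * (modc z / t) ^+ n.
  have [g [g0 gE ag]] := divide_out_monomial n fc.
  have gM x : modc x <= t -> modc (g x) <= K / t ^+ n.
    apply: maximum_modulus => {}x xt; first by apply/ag/af/(le_trans xt)/ltW.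
    have x0 : x != 0 by rewrite -modc_gt0 xt.
    rewrite ler_pdivlMr ?exprn_gt0 // -xt -modcX -modcM mulrC.
    rewrite (_ : x ^+ n * g x = f x - \sum_(0 <= k < n) c k * x ^+ k);
      last first.
      by rewrite gE // [X in X - _]addrC addrK.
    apply: (le_trans (modcB _ _)); apply: lerD.
      by apply: (maximum_modulus af fM); rewrite xt ltW.
    apply: (le_trans (modc_sum _ _ _)).
    apply: (@le_trans _ _ (\sum_(0 <= k < n) M * (t / r) ^+ k)).
      apply: ler_sum => k _; rewrite modcM modcX xt expr_div_n mulrA.
      by rewrite ler_pdivlMr ?exprn_gt0 // mulrAC ler_wpM2r ?exprn_ge0 // ltW.
    by rewrite -mulr_sumr ler_wpM2l // sum_geometric_le.
  rewrite gE // [X in modc (X - _)]addrC addrK modcM modcX expr_div_n.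
  rewrite mulrCA ler_wpM2l ?exprn_ge0 ?modc_ge0 //.
  by apply: gM; exact: ltW.
apply/cvg_modcP => e e0.
have q1 : `|modc z / t| < 1.
  by rewrite ger0_norm ?divr_ge0 ?modc_ge0 ?ltW // ltr_pdivrMr ?mul1r.
have /cvgrPdist_lt /(_ e e0) := cvg_geometric K q1.
apply: filterS => n /=; rewrite sub0r normrN => h.
by apply: le_lt_trans (main n) (le_lt_trans (ler_norm _) h).
Qed.

Lemma analytic_bounded r f :
  0 <= r -> (forall z, modc z <= r -> analytic_at f z) ->
  exists M : R, forall z, modc z <= r -> modc (f z) <= M.
Proof.
move=> r0 af.
have fc : {within [set z : C | modc z <= r], continuous (fun z => modc (f z))}.
  apply: continuous_in_subspaceT => x; rewrite inE /= => xr.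
  exact: (continuous_modc (analytic_at_continuous (af x xr))).
have z0 : modc (0 : C) <= r by rewrite modc0.
have [a _ fa] := compact_EVT_max (ex_intro _ 0 z0) (@compact_modc_le R r) fc.
by exists (modc (f a)) => z zr; apply: fa; rewrite inE.
Qed.

Lemma analytic_ball_has_ps r f : 0 < r ->
  (forall z, modc z <= r -> analytic_at f z) -> exists c, has_ps r f c.
Proof.
move=> r0 af; have z0 : modc (0 : C) <= r by rewrite modc0 ltW.
have [M fM] := analytic_bounded (ltW r0) af.
have /analytic_atP[s [c fc]] := af 0 z0.
have {}fc : has_ps s f c by apply: eq_has_ps fc => h _; rewrite add0r.
exists c; apply: (analytic_has_ps r0 fc af (M := M)) => z zr.
by apply: fM; rewrite zr.
Qed.

End MaximumModulus.

(** * Finite Blaschke products *)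

Section Blaschke.
Variable R : realType.
Local Notation C := (Cplx R).
Local Notation "r %:C" := (real_complex R r : C).
Implicit Types (z w h u : C) (r : R) (f g : C -> C) (c d : nat -> C).

Lemma blaschke0 lam z : blaschke lam 0 z = 1.
Proof. by rewrite /blaschke big_geq. Qed.

Lemma blaschkeS lam n z : blaschke lam n.+1 z =
  blaschke lam n z * ((lam n.+1 - z) / (1 - conjc (lam n.+1) * z)).
Proof. by rewrite /blaschke big_nat_recr. Qed.

Lemma blaschke_cat (lam : nat -> C) p m z :
  blaschke lam (p + m) z =
  blaschke lam p z * blaschke (fun k => lam (p + k)%N) m z.
Proof.
elim: m => [|m IH]; first by rewrite addn0 blaschke0 mulr1.
by rewrite addnS !blaschkeS IH -mulrA /= addnS.
Qed.

Lemma blaschke_first_zero (lam : nat -> C) m : blaschke lam m.+1 (lam 1) = 0.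
Proof.
elim: m => [|m IH]; first by rewrite blaschkeS subrr mul0r mulr0.
by rewrite blaschkeS IH mul0r.
Qed.

(** Since [modc (1 - conjc a * z) <= 2], the deficit in [modc_mobius] is at
    least a fixed multiple of [1 - modc a]. The constant 8 is 4 from that
    bound times 2 from passing to the square root. *)
Lemma modc_blaschke_factor (a z : C) (s : R) :
  modc a < 1 -> s <= 1 -> modc z <= s ->
  modc ((a - z) / (1 - conjc a * z)) <= 1 - (1 - s ^+ 2) / 8 * (1 - modc a).
Proof.
move=> a1 s1 zs.
have z0 := modc_ge0 z; have a0 := modc_ge0 a.
have d0 : 0 < modc (1 - conjc a * z).
  rewrite modc_gt0; apply: one_sub_neq0; rewrite modc_conj.
  by apply: le_lt_trans a1; rewrite ler_piMr //; lra.
have d2 : modc (1 - conjc a * z) <= 2.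
  by apply: (le_trans (modcB _ _)); rewrite modc1 modcM modc_conj; nra.
have E := modc_mobius a z.
have n0 := modc_ge0 (a - z).
rewrite modcM modcV ler_pdivrMr //.
move: (modc (1 - _)) (modc (a - z)) (modc a) (modc z) d0 d2 E n0 z0 a0 a1 zs.
move=> d n x y d0 d2 E n0 y0 x0 x1 ys.
set k := (1 - s ^+ 2) / 8.
have k0 : 0 <= k by rewrite /k; nra.
have k1 : k <= 1 / 8 by rewrite /k; nra.
have kx : 0 <= k * (1 - x) <= 1 / 8.
  apply/andP; split; first by rewrite mulr_ge0 // subr_ge0 ltW.
  by apply: le_trans k1; rewrite ler_piMr //; lra.
have {}E : n ^+ 2 <= d ^+ 2 - 8 * k * (1 - x).
  have A1 : 1 - x <= 1 - x ^+ 2 by nra.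
  have A2 : 8 * k <= 1 - y ^+ 2 by rewrite /k; nra.
  have A3 : (1 - x) * (8 * k) <= (1 - x ^+ 2) * (1 - y ^+ 2).
    by apply: ler_pM => //; [rewrite subr_ge0 ltW|rewrite mulr_ge0 ?ler0n].
  rewrite lerBrDr [8 * k * _]mulrC -lerBrDl; apply: (le_trans A3).
  by rewrite E addrAC subrr add0r.
rewrite -(@ler_pXn2r _ 2) ?nnegrE //; last first.
  by rewrite mulr_ge0 ?(ltW d0) //; lra.
apply: (le_trans E); rewrite exprMn.
move: kx; set t := k * (1 - x) => /andP[t0 t8].
have : d ^+ 2 <= 4 by nra.
have -> : 8 * k * (1 - x) = 8 * t by rewrite /t; ring.
have := sqr_ge0 d; move: (d ^+ 2) => q q0 q4.
nra.
Qed.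

(** From [(1 - x) * (1 + x) <= 1]: the product is at most the inverse of one
    plus the sum, so it tends to [0] when the sum diverges. *)
Lemma prod_one_sub_le (x : nat -> R) n : (forall k, 0 <= x k <= 1) ->
  0 <= \prod_(1 <= k < n.+1) (1 - x k) /\
  \prod_(1 <= k < n.+1) (1 - x k) * (1 + \sum_(1 <= k < n.+1) x k) <= 1.
Proof.
move=> x01; elim: n => [|n [P0 IH]]; first by rewrite !big_geq // addr0 mulr1.
have S0 : 0 <= \sum_(1 <= k < n.+1) x k.
  by apply: sumr_ge0 => k _; have /andP[] := x01 k.
have -> : \prod_(1 <= k < n.+2) (1 - x k) =
    \prod_(1 <= k < n.+1) (1 - x k) * (1 - x n.+1) by rewrite big_nat_recr.
have -> : \sum_(1 <= k < n.+2) x k = \sum_(1 <= k < n.+1) x k + x n.+1.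
  by rewrite big_nat_recr.
have /andP[y0 y1] := x01 n.+1.
move: y0 y1 P0 IH S0.
move: (x n.+1) (\prod_(1 <= k < n.+1) (1 - x k)) (\sum_(1 <= k < n.+1) x k).
move=> y P S y0 y1 P0 IH S0; split.
  by apply: mulr_ge0; rewrite ?subr_ge0.
apply: le_trans IH; rewrite -mulrA ler_wpM2l //; nra.
Qed.

Section Disk.
Variable lam : nat -> C.
Hypothesis lam1 : forall n, (1 <= n)%N -> modc (lam n) < 1.

Lemma blaschke_denom_neq0 n z : (1 <= n)%N -> modc z <= 1 ->
  1 - conjc (lam n) * z != 0.
Proof.
move=> n1 z1; apply: one_sub_neq0; rewrite modc_conj.
by apply: le_lt_trans (lam1 n1); rewrite ler_piMr ?modc_ge0.
Qed.

Lemma analytic_at_blaschke_off_poles n z :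
  (forall k, (1 <= k <= n)%N -> modc (lam k) * modc z < 1) ->
  analytic_at (blaschke lam n) z.
Proof.
elim: n => [_|n IH lz].
  by apply: eq_analytic_at (analytic_at_cst 1 z) => x; rewrite blaschke0.
have d0 : 1 + - conjc (lam n.+1) * z != 0.
  by rewrite mulNr; apply: one_sub_neq0; rewrite modc_conj lz ?leqnn.
have {}IH : analytic_at (blaschke lam n) z.
  by apply: IH => k /andP[k1 kn]; rewrite lz // k1 leqW.
have := analytic_at_div_affine d0 (analytic_at_mul_affine (lam n.+1) (-1) IH).
apply: eq_analytic_at => x.
by rewrite blaschkeS mulN1r mulNr mulrA; congr (_ / _); rewrite mulrC.
Qed.

Lemma analytic_at_blaschke n z : modc z <= 1 -> analytic_at (blaschke lam n) z.
Proof.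
move=> z1; apply: analytic_at_blaschke_off_poles => k /andP[k1 _].
by apply: le_lt_trans (lam1 k1); rewrite ler_piMr ?modc_ge0.
Qed.

Lemma modc_blaschke_le1 n z : modc z <= 1 -> modc (blaschke lam n z) <= 1.
Proof.
move=> z1; elim: n => [|n IH]; first by rewrite blaschke0 modc1.
rewrite blaschkeS modcM mulr_ile1 ?modc_ge0 //.
have := modc_blaschke_factor (lam1 (ltn0Sn n)) (lexx 1) z1.
by rewrite expr1n subrr mul0r mul0r subr0.
Qed.

(** The circle of this radius surrounds the zeros of [blaschke lam n], and
    the circle of inverse radius leaves its poles outside. *)
Lemma exists_radius n : exists2 r : R, 0 < r < 1 &
  forall k, (1 <= k <= n)%N -> modc (lam k) < r.
Proof.
elim: n => [|n [r /andP[r0 r1] lr]].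
  by exists (1 / 2); [apply/andP; split; lra|move=> [|k]].
have l1 := lam1 (ltn0Sn n); have l0 := modc_ge0 (lam n.+1).
exists (Num.max r ((modc (lam n.+1) + 1) / 2)).
  by rewrite lt_max r0 gt_max r1 /=; lra.
move=> k /andP[k1]; rewrite leq_eqVlt => /predU1P[->|]; rewrite lt_max.
  by apply/orP; right; lra.
by rewrite ltnS => kn; rewrite lr // k1.
Qed.

(** On the circle of radius [r] each factor has modulus at least
    [(r - modc (lam k)) / 2]. *)
Lemma blaschke_lower_bound n r : r < 1 ->
  (forall k, (1 <= k <= n)%N -> modc (lam k) < r) ->
  exists2 e : R, 0 < e & forall z, modc z = r -> e <= modc (blaschke lam n z).
Proof.
move=> r1; elim: n => [_|n IH lr].
  by exists 1 => // z _; rewrite blaschke0 modc1.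
have [|e e0 he] := IH.
  by move=> k /andP[k1 kn]; rewrite lr // k1 leqW.
have lnr : modc (lam n.+1) < r by rewrite lr ?leqnn.
exists (e * ((r - modc (lam n.+1)) / 2)) => [|z zr].
  by rewrite mulr_gt0 // divr_gt0 // subr_gt0.
have z1 : modc z <= 1 by rewrite zr ltW.
rewrite blaschkeS modcM; apply: ler_pM.
- exact: ltW.
- by rewrite divr_ge0 // subr_ge0 ltW.
- exact: he.
rewrite modcM modcV; apply: ler_pM.
- by rewrite subr_ge0 ltW.
- by [].
- by rewrite modc_distC -zr; exact: modcBr.
rewrite lef_pV2 ?posrE // ?modc_gt0 ?blaschke_denom_neq0 //.
have l1 := lam1 (ltn0Sn n); have l0 := modc_ge0 (lam n.+1).
apply: (le_trans (modcB _ _)); rewrite modc1 modcM modc_conj zr; nra.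
Qed.

Hypothesis lam_sum : (\sum_(1 <= n <oo) (1 - modc (lam n))%:E = +oo)%E.

Lemma blaschke_condition_partial_sums (A : R) :
  exists n0, forall n, (n0 <= n)%N ->
  A <= \sum_(1 <= k < n.+1) (1 - modc (lam k)).
Proof.
have d0 n : (1 <= n)%N -> (0 <= (1 - modc (lam n))%:E)%E.
  by move=> n1; rewrite lee_fin subr_ge0 ltW // lam1.
have : (\sum_(1 <= k < n) (1 - modc (lam k))%:E)%E @[n --> \oo] --> +oo%E.
  rewrite -lam_sum; apply: is_cvg_nneseries => n n1 _; exact: d0.
move=> /cvgeyPge/(_ A)[n0 _ h]; exists n0 => n n0n.
have := h n.+1 (leqW n0n); by rewrite /= sumEFin lee_fin.
Qed.

(** This is where the divergence of the sum of [1 - modc (lam n)] enters: by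
    [modc_blaschke_factor] and [prod_one_sub_le] the Blaschke products tend
    to [0] uniformly on every disk of radius less than one. *)
Lemma blaschke_decay (s e : R) : 0 <= s < 1 -> 0 < e ->
  exists n0, forall n u, (n0 <= n)%N -> modc u <= s ->
    modc (blaschke lam n u) <= e.
Proof.
move=> /andP[s0 s1] e0; pose k := (1 - s ^+ 2) / 8.
have k0 : 0 < k by rewrite /k; nra.
have k1 : k <= 1 by rewrite /k; nra.
have [n0 hn] := blaschke_condition_partial_sums ((k * e)^-1).
exists n0 => n u n0n us.
(* lam 0 is arbitrary, so x 0 is set to 0 to keep all the x m in [0, 1]. *)
pose x m := if m is 0 then 0 else k * (1 - modc (lam m)).
have x01 m : 0 <= x m <= 1.
  case: m => [|m]; rewrite /x ?lexx ?ler01 //.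
  have := lam1 (ltn0Sn m); have := modc_ge0 (lam m.+1).
  by move: (modc _) => t t0 t1; apply/andP; split; nra.
apply: (@le_trans _ _ (\prod_(1 <= m < n.+1) (1 - x m))).
  rewrite /blaschke modc_prod; rewrite big_nat_cond [leRHS]big_nat_cond.
  apply: ler_prod => -[|m] // _.
  rewrite modc_ge0 /=.
  exact: modc_blaschke_factor (lam1 (ltn0Sn m)) (ltW s1) us.
have [P0 P1] := prod_one_sub_le n x01.
have xS : \sum_(1 <= m < n.+1) x m =
    k * \sum_(1 <= m < n.+1) (1 - modc (lam m)).
  rewrite mulr_sumr big_nat_cond [RHS]big_nat_cond.
  by apply: eq_bigr => -[|m].
have := hn n n0n; rewrite xS in P1 => hS.
have kS : e^-1 <= k * \sum_(1 <= m < n.+1) (1 - modc (lam m)).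
  by rewrite -ler_pdivrMl // -invfM.
move: P0 P1 kS; move: (\prod_(1 <= m < n.+1) _) (k * _) => P S P0 P1 kS.
have : P * e^-1 <= 1.
  by apply: le_trans P1; rewrite ler_wpM2l // ler_wpDl.
by rewrite ler_pdivrMr // mul1r.
Qed.

End Disk.

End Blaschke.

(** * Expansion in Blaschke products *)

Section Expansion.
Variable R : realType.
Local Notation C := (Cplx R).
Local Notation "r %:C" := (real_complex R r : C).
Implicit Types (z w h u : C) (r : R) (f g : C -> C) (c d : nat -> C).

Variable lam : nat -> C.
Hypothesis lam1 : forall n, (1 <= n)%N -> modc (lam n) < 1.

Definition conj_seq (n : nat) : C := conjc (lam n).

Lemma conj_seq1 n : (1 <= n)%N -> modc (conj_seq n) < 1.
Proof. by move=> n1; rewrite modc_conj lam1. Qed.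

(** [newton_coef k u] is the coefficient of [blaschke lam k] in the Newton
    interpolation of [z |-> 1 / (1 - z * u)] at the points [lam 1], [lam 2],
    and so on. *)
Definition newton_coef (k : nat) u : C :=
  if k is n.+1 then
    - (blaschke conj_seq n u * u * (1 - conjc (lam n.+1) * lam n.+2)
       / (1 - lam n.+1 * u) / (1 - lam n.+2 * u))
  else (1 - lam 1 * u)^-1.

(** The difference between [1 / (1 - z * u)] and its interpolant at [lam 1],
    ..., [lam n.+1]: a rational function of [z] with the poles of
    [blaschke lam n] and [1 / u] that vanishes at these nodes. The factor
    depending on [u] alone is fixed by the residue at [1 / u] and contains a
    Blaschke product in [u], which makes it small. *)
Definition newton_remainder (n : nat) z u : C :=
  blaschke lam n z * (blaschke conj_seq n u * u * (z - lam n.+1)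
     / (1 - lam n.+1 * u) / (1 - z * u)).

(** Two consecutive remainders differ by one Newton term; after the common
    Blaschke products are removed this is an identity between rational
    functions with affine factors. *)
Lemma newton_expansion n z u : modc z <= 1 -> modc u < 1 ->
  (1 - z * u)^-1 =
  \sum_(0 <= k < n.+1) blaschke lam k z * newton_coef k u
    + newton_remainder n z u.
Proof.
move=> z1 u1.
have zu : 1 - z * u != 0.
  by apply: one_sub_neq0; apply: le_lt_trans u1; rewrite ler_piMl ?modc_ge0.
have lu k : (1 <= k)%N -> 1 - lam k * u != 0.
  move=> k1; apply: one_sub_neq0; apply: le_lt_trans (lam1 k1).
  by rewrite ler_piMr ?modc_ge0 // ltW.
elim: n => [|n IH].
  rewrite big_nat1 /newton_remainder !blaschke0 /= !mul1r.
  have := lu 1 isT; move: (lam 1) => a au; by field; rewrite au zu.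
rewrite big_nat_recr // IH -!addrA; congr (_ + _).
rewrite /newton_remainder /newton_coef !blaschkeS.
have lz := blaschke_denom_neq0 lam1 (ltn0Sn n) z1.
have := lu n.+1 isT; have := lu n.+2 isT; move: lz zu.
rewrite /conj_seq conjcK.
move: (blaschke lam n z) (blaschke _ n u) (conjc (lam n.+1)).
move: (lam n.+1) (lam n.+2).
clear => a a' P Q b h1 h2 h3 h4.
by field; rewrite h1 h2 h3 h4.
Qed.

Lemma analytic_at_newton_coef k u : modc u < 1 -> analytic_at (newton_coef k) u.
Proof.
move=> u1.
have lu m : (1 <= m)%N -> 1 + - lam m * u != 0.
  move=> m1; rewrite mulNr; apply: one_sub_neq0; apply: le_lt_trans (lam1 m1).
  by rewrite ler_piMr ?modc_ge0 // ltW.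
case: k => [|n] /=.
  have := analytic_at_div_affine (lu 1 isT) (analytic_at_cst 1 u).
  by apply: eq_analytic_at => x; rewrite mul1r mulNr.
have := analytic_at_blaschke conj_seq1 n (ltW u1).
move=> /(analytic_at_mul_affine 0 1).
move=> /(analytic_atZ (- (1 - conjc (lam n.+1) * lam n.+2))).
move=> /(analytic_at_div_affine (lu n.+1 isT)).
move=> /(analytic_at_div_affine (lu n.+2 isT)).
apply: eq_analytic_at => x; rewrite !mulNr; congr (- _).
by congr (_ / _ / _); ring.
Qed.

Lemma analytic_at_newton_remainder n z u : modc z <= 1 -> modc u < 1 ->
  analytic_at (newton_remainder n z) u.
Proof.
move=> z1 u1.
have lu m : (1 <= m)%N -> 1 + - lam m * u != 0.
  move=> m1; rewrite mulNr; apply: one_sub_neq0; apply: le_lt_trans (lam1 m1).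
  by rewrite ler_piMr ?modc_ge0 // ltW.
have zu : 1 + - z * u != 0.
  rewrite mulNr; apply: one_sub_neq0; apply: le_lt_trans u1.
  by rewrite ler_piMl ?modc_ge0.
apply: analytic_atZ.
have := analytic_at_blaschke conj_seq1 n (ltW u1).
move=> /(analytic_at_mul_affine 0 1).
move=> /(analytic_atZ (z - lam n.+1)).
move=> /(analytic_at_div_affine (lu n.+1 isT)).
move=> /(analytic_at_div_affine zu).
by apply: eq_analytic_at => x; rewrite !mulNr; congr (_ / _ / _); ring.
Qed.

Lemma modc_newton_remainder n z u (s e : R) :
  modc z <= 1 -> modc u <= s -> s < 1 ->
  modc (blaschke conj_seq n u) <= e ->
  modc (newton_remainder n z u) <= 2 * e / (1 - s) ^+ 2.
Proof.
move=> z1 us s1 Be.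
have s0 : 0 < 1 - s by rewrite subr_gt0.
have d1 (a : C) : modc a <= 1 -> 1 - s <= modc (1 - a * u).
  move=> a1; apply: le_trans (modcBr _ _); rewrite modc1 lerD2l lerN2 modcM.
  by apply: le_trans us; rewrite ler_piMl ?modc_ge0.
have l1 := lam1 (ltn0Sn n).
have da := d1 _ (ltW l1); have dz := d1 _ z1.
have B1 := modc_blaschke_le1 lam1 n z1.
have zl : modc (z - lam n.+1) <= 2.
  by apply: (le_trans (modcB _ _)); lra.
have u1 : modc u <= 1 by apply: le_trans us (ltW s1).
rewrite /newton_remainder !modcM !modcV.
have e0 : 0 <= e by apply: le_trans Be; exact: modc_ge0.
apply: (@le_trans _ _ (1 * (e * 1 * 2 / (1 - s) / (1 - s)))); last first.
  rewrite mul1r mulr1 le_eqVlt; apply/orP; left; apply/eqP; field.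
  by rewrite gt_eqF.
have iv x : 1 - s <= x -> x^-1 <= (1 - s)^-1.
  by move=> sx; rewrite lef_pV2 ?posrE // (lt_le_trans s0).
have ge0 x : 1 - s <= x -> 0 <= x^-1.
  by move=> sx; rewrite invr_ge0 ltW // (lt_le_trans s0).
by do !(apply: ler_pM => //; rewrite ?mulr_ge0 ?modc_ge0 ?iv ?ge0 //).
Qed.

(** The coefficient of [u ^ m] in the kernel [1 / (1 - z * u)] is [z ^+ m].
    Hence the coefficients of the remainder, as a power series in [u], are
    the errors made when the monomial [z ^+ m] is expanded in Blaschke
    products. *)
Lemma has_ps_newton_remainder n z (s : R) (a : nat -> nat -> C) :
  modc z <= 1 -> 0 < s < 1 -> (forall k, has_ps s (newton_coef k) (a k)) ->
  has_ps s (newton_remainder n z)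
    (fun m => z ^+ m - \sum_(0 <= k < n.+1) blaschke lam k z * a k m).
Proof.
move=> z1 /andP[s0 s1] ha.
have zs : modc z * s < 1 by apply: le_lt_trans s1; rewrite ler_piMl // ltW.
have H1 := has_ps_geometric s0 zs.
have H2 := has_ps_sum (index_iota 0 n.+1) s0
  (fun k => has_psZ (blaschke lam k z) (ha k)).
have H := has_psD H1 (has_psZ (-1) H2).
rewrite (_ : (fun m : nat => _) = (fun m : nat => z ^+ m +
   -1 * \sum_(0 <= k < n.+1) blaschke lam k z * a k m)); last first.
  by apply/funext => m; rewrite mulN1r.
apply: (eq_has_ps _ H) => h hs.
rewrite (newton_expansion n z1 (lt_trans hs s1)) mulN1r.
by rewrite [X in X - _]addrC addrK.
Qed.

(** If [d p] is the first nonzero coefficient, the partial sums are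
    divisible by [blaschke lam p]. On a circle around the first [p.+1] zeros
    this factor is bounded away from [0], so the quotients tend to [0]
    uniformly there, hence also inside. But at [lam p.+1] all the quotients
    take the value [d p]. *)
Lemma blaschke_coef_unique d :
  (forall r e : R, 0 < r < 1 -> 0 < e -> exists n0, forall n z, (n0 <= n)%N ->
     modc z <= r -> modc (\sum_(0 <= k < n) d k * blaschke lam k z) <= e) ->
  forall p, d p = 0.
Proof.
move=> hd; elim/ltn_ind => p IH; apply/eqP; apply: contraT => dp0.
have dpos : 0 < modc (d p) by rewrite modc_gt0.
have [r rI lr] := exists_radius lam1 p.+1; have /andP[r0 r1] := rI.
have [|e e0 he] := blaschke_lower_bound lam1 (n := p) r1.
  by move=> k /andP[k1 kp]; rewrite lr // k1 leqW.
have [|n0 hn] := hd r (e * (modc (d p) / 2)) rI.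
  by rewrite mulr_gt0 // divr_gt0.
(* G has n0.+1 terms, so that the partial sum of length p + n0.+1 is beyond n0
   and contains the term of index p. *)
pose mu k := lam (p + k)%N.
have mu1 k : (1 <= k)%N -> modc (mu k) < 1.
  by move=> k1; apply: lam1; apply: leq_trans k1 (leq_addl _ _).
pose G z := \sum_(0 <= m < n0.+1) d (p + m)%N * blaschke mu m z.
have GE z : \sum_(0 <= k < (p + n0.+1)%N) d k * blaschke lam k z =
    blaschke lam p z * G z.
  rewrite (@big_cat_nat _ _ _ p) ?leq_addr //= big1_seq ?add0r; last first.
    by move=> k; rewrite mem_index_iota => /= kp; rewrite IH ?mul0r.
  rewrite (_ : \sum_(p <= k < (p + n0.+1)%N) d k * blaschke lam k z =
     \sum_(0 <= m < n0.+1) d (p + m)%N * blaschke lam (p + m)%N z); last first.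
    rewrite -{1}(add0n p) big_addn addKn.
    by apply: eq_bigr => m _; rewrite addnC.
  by rewrite mulr_sumr; apply: eq_bigr => m _; rewrite blaschke_cat mulrCA.
have Gl : G (lam p.+1) = d p.
  rewrite /G big_nat_recl // blaschke0 mulr1 addn0 big1 ?addr0 // => m _.
  by rewrite (_ : lam p.+1 = mu 1) ?blaschke_first_zero ?mulr0 // /mu addn1.
have lp : modc (lam p.+1) <= r by rewrite ltW // lr ?leqnn.
suff : modc (G (lam p.+1)) <= modc (d p) / 2 by rewrite Gl; lra.
apply: (@maximum_modulus _ r) => // z zr.
  apply: analytic_at_sum => m _; apply: analytic_atZ.
  by apply: analytic_at_blaschke => //; apply: le_trans zr (ltW r1).
have := hn (p + n0.+1)%N z; rewrite zr lexx addnS => /(_ _ isT) H.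
have {}H := H (leqW (leq_addl _ _)).
rewrite -addnS GE modcM in H.
rewrite -(ler_pM2l e0); apply: le_trans H; rewrite ler_wpM2r ?modc_ge0 //.
exact: he.
Qed.

Hypothesis lam_sum : (\sum_(1 <= n <oo) (1 - modc (lam n))%:E = +oo)%E.

Lemma conj_seq_sum : (\sum_(1 <= n <oo) (1 - modc (conj_seq n))%:E = +oo)%E.
Proof.
by rewrite -lam_sum; apply: eq_eseriesr => n _; rewrite modc_conj.
Qed.

(** Write [f z] as the sum of [c m * z ^+ m] and expand each monomial.
    Cauchy estimates in [u] on the circle of radius [s], with
    [1 / rho < s < 1], bound the error for [z ^+ m] by a small multiple of
    [s ^- m], uniformly in [z], whereas [c m] is at most a multiple of
    [rho ^- m]; the geometric series of ratio [q = 1 / (rho * s)] sums the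
    errors. *)
Lemma blaschke_expansion (rho : R) f : 1 < rho ->
  (forall z, modc z <= rho -> analytic_at f z) ->
  exists a : nat -> C, forall e : R, 0 < e ->
  exists n0, forall n z, (n0 <= n)%N ->
    modc z <= 1 ->
    modc (f z - \sum_(0 <= k < n.+1) a k * blaschke lam k z) <= e.
Proof.
move=> rho1 af; have rho0 : 0 < rho by apply: lt_trans rho1.
have [c fc] := analytic_ball_has_ps rho0 af.
have [_ [M cM] cf] := fc.
have M0 : 0 <= M by apply: le_trans (cM 0); rewrite mulr_ge0 ?modc_ge0.
have [s rs s1] : exists2 s : R, 1 < rho * s & s < 1.
  exists ((rho^-1 + 1) / 2).
    by rewrite mulrA mulrDr divff ?gt_eqF // mulr1 ltr_pdivlMr //; lra.
  have : rho^-1 < 1 by rewrite invf_lt1.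
  lra.
have s0 : 0 < s by have := lt_trans (ltr01 : 0 < 1 :> R) rs; rewrite pmulr_rgt0.
have sI : 0 < s < 1 by rewrite s0.
pose q := (rho * s)^-1.
have q0 : 0 < q by rewrite invr_gt0 mulr_gt0.
have q01 : 0 <= q < 1 by rewrite ltW //= invf_lt1 // mulr_gt0.
have /choice[a ha] : forall k, exists ak, has_ps s (newton_coef k) ak.
  move=> k; apply: analytic_ball_has_ps => // u us.
  by apply: analytic_at_newton_coef; apply: le_lt_trans us s1.
have cd (d : C) K m : modc d * s ^+ m <= K -> modc (c m * d) <= M * K * q ^+ m.
  move=> dK; rewrite /q exprVn ler_pdivlMr ?exprn_gt0 ?mulr_gt0 // modcM.
  rewrite exprMn mulrACA; apply: ler_pM => //;
  by rewrite mulr_ge0 ?modc_ge0 ?exprn_ge0 // ltW.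
have /choice[al hal] : forall k, exists al : C,
    series (fun m => c m * a k m) @ \oo --> al.
  move=> k; have [_ [K aK] _] := ha k.
  have [l cl _] := cvg_geom_dominated q01 (fun m => cd _ _ _ (aK m)).
  by exists l.
exists al => e e0.
have q1 : 0 < 1 - q by case/andP: q01 => _; rewrite subr_gt0.
(* eta is the bound on the conjugate Blaschke product that makes the final
   estimate M * (2 * eta / (1 - s)^2) / (1 - q) at most e; M + 1 avoids a
   division by zero. *)
pose eta := e * (1 - q) * (1 - s) ^+ 2 / (2 * (M + 1)).
have M1 : 0 < M + 1 by rewrite ltr_wpDl.
have s1' : 0 < 1 - s by rewrite subr_gt0.
have eta0 : 0 < eta by rewrite divr_gt0 // ?mulr_gt0 ?exprn_gt0.
have sI' : 0 <= s < 1 by rewrite ltW.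
have [n0 hn0] := blaschke_decay conj_seq1 conj_seq_sum sI' eta0.
exists n0 => n z n0n z1.
pose D m := z ^+ m - \sum_(0 <= k < n.+1) blaschke lam k z * a k m.
have DE m : modc (D m) * s ^+ m <= 2 * eta / (1 - s) ^+ 2.
  apply: (cauchy_estimate s0 (has_ps_newton_remainder n z1 sI ha)) => u us.
    by apply: analytic_at_newton_remainder => //; apply: le_lt_trans us s1.
  by apply: modc_newton_remainder => //; rewrite ?us // hn0 // us.
have [l cl /(_ 0)] := cvg_geom_dominated q01 (fun m => cd _ _ _ (DE m)).
rewrite /series /= big_geq // subr0 expr0 mulr1 => lb.
suff <- : l = f z - \sum_(0 <= k < n.+1) al k * blaschke lam k z.
  apply: (le_trans lb); rewrite ler_pdivrMr // /eta.
  rewrite (_ : M * _ = e * (1 - q) * (M / (M + 1))); last first.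
    by field; rewrite !gt_eqF // subr_gt0.
  rewrite ler_piMr ?mulr_ge0 ?(ltW e0) ?(ltW q1) //.
  by rewrite ler_pdivrMr // mul1r lerDl.
have zr : modc z < rho by apply: le_lt_trans rho1.
apply: (cvg_unique (@norm_hausdorff _ _) cl).
rewrite (_ : series _ = fun N => series (fun m => c m * z ^+ m) N -
   \sum_(0 <= k < n.+1) series (fun m => c m * a k m) N * blaschke lam k z).
  apply: cvgB; first exact: cf.
  apply: cvg_big => [|k _]; last by apply: cvgMl; exact: hal.
  exact: add_continuous.
apply/funext => N; rewrite /series /=.
under [X in _ = _ - X]eq_bigr => k _ do rewrite mulr_suml.
rewrite exchange_big /= -sumrB; apply: eq_bigr => m _.
rewrite /D mulrBr mulr_sumr; congr (_ - _); apply: eq_bigr => k _.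
by rewrite mulrCA mulrC.
Qed.

End Expansion.

(** * Spaces between the disk algebra and the analytic functions *)

Section Space.
Variable R : realType.
Local Notation C := (Cplx R).
Local Notation "r %:C" := (real_complex R r : C).
Implicit Types (z w h u : C) (r : R) (f g : C -> C) (c d : nat -> C).

Lemma diskE z : disk z <-> modc z < 1.
Proof. by rewrite /disk /= normr_modc -(ltc_real (modc z) 1). Qed.

Lemma cdiskE z : cdisk z <-> modc z <= 1.
Proof. by rewrite /cdisk /= normr_modc -(lec_real (modc z) 1). Qed.

(** The part of the disk of radius 2 outside the open set is compact, so it
    has a point closest to the origin, and that point is outside the closed
    unit disk. *)
Lemma hol_cdisk_radius f : hol_cdisk f ->
  exists2 rho : R, 1 < rho & forall z, modc z <= rho -> analytic_at f z.
Proof.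
move=> [U [oU cU aU]].
have cK : compact (~` U `&` [set z : C | modc z <= 2]).
  rewrite setIC; apply: compact_closedI; last exact: open_closedC.
  exact: compact_modc_le.
have [K0|K0] := pselect ((~` U `&` [set z : C | modc z <= 2]) !=set0);
  last first.
  exists 2 => [|z z2]; first by rewrite ltr1n.
  by apply: aU; apply: contrapT => nU; apply: K0; exists z.
have nc : {within ~` U `&` [set z : C | modc z <= 2],
    continuous (fun z => - modc z)}.
  apply: continuous_subspaceT => z; exact: (cvgN (@modc_continuous R z)).
have [a] := compact_EVT_max K0 cK nc; rewrite inE => -[/= nUa a2] ha.
have a1 : 1 < modc a.
  by rewrite ltNge; apply/negP => a1; apply: nUa; apply: cU; apply/cdiskE.
exists ((1 + modc a) / 2) => [|z zr]; first by lra.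
apply: aU; apply: contrapT => nU.
have : - modc z <= - modc a.
  by apply: ha; rewrite inE; split => //=; lra.
by lra.
Qed.

Lemma analytic_disk_algebra f :
  (forall z, modc z <= 1 -> analytic_at f z) -> disk_algebra f.
Proof.
move=> af; split=> [z /diskE z1|]; first exact/af/ltW.
apply: continuous_in_subspaceT => z; rewrite inE => /cdiskE z1.
exact/analytic_at_continuous/af.
Qed.

Lemma blaschke_hol_cdisk (lam : nat -> C) n :
  (forall n, (1 <= n)%N -> modc (lam n) < 1) -> hol_cdisk (blaschke lam n).
Proof.
move=> lam1; have [r /andP[r0 r1] lr] := exists_radius lam1 n.
exists [set z : C | modc z < r^-1]; split.
- rewrite (_ : [set z | _] = (@modc R) @^-1` [set x | x < r^-1]); last by [].
  apply: open_comp; last exact: open_lt.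
  by move=> z _; exact: modc_continuous.
- by move=> z /cdiskE z1 /=; apply: le_lt_trans z1 _; rewrite invf_gt1.
- move=> z /= zr; apply: analytic_at_blaschke_off_poles => k kn.
  have := lr k kn; have := modc_ge0 (lam k); have := modc_ge0 z.
  move: zr; rewrite -[r^-1]mul1r ltr_pdivlMr // => zr z0 l0 lkr.
  apply: le_lt_trans zr; rewrite mulrC ler_wpM2l // ltW //.
Qed.

Section Embedding.
Variables (X : completeNormedModType C) (ev : X -> C -> C) (j : (C -> C) -> X).
Hypothesis hX : space_of_analytic_functions ev.
Hypothesis hA : disk_algebra_embedded ev j.
Hypothesis hH : embedded_in_hol_disk ev.

Lemma ev0 z : disk z -> ev 0 z = 0.
Proof.
move=> dz; have [lin _ _] := hX; have := lin 1 0 0 z dz.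
rewrite scale1r addr0 mul1r => E.
by apply: (addrI (ev 0 z)); rewrite addr0 -E.
Qed.

Lemma ev_sum (a : nat -> C) (x : nat -> X) n z : disk z ->
  ev (\sum_(0 <= k < n) a k *: x k) z = \sum_(0 <= k < n) a k * ev (x k) z.
Proof.
move=> dz; have [lin _ _] := hX.
elim: n => [|n IH]; first by rewrite !big_geq // ev0.
by rewrite !big_nat_recr //= addrC lin // IH addrC.
Qed.

(** Linearity of the inclusion of the disk algebra follows from the fact
    that vectors are determined by their values on the disk. *)
Lemma inclusion_sum (a : nat -> C) (f : nat -> C -> C) n :
  (forall k z, modc z <= 1 -> analytic_at (f k) z) ->
  j (fun z => \sum_(0 <= k < n) a k * f k z) = \sum_(0 <= k < n) a k *: j (f k).
Proof.
move=> af; have [_ inj _] := hX; have [jE _] := hA.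
apply: inj => z dz; rewrite ev_sum // jE //; last first.
  apply: analytic_disk_algebra => w w1; apply: analytic_at_sum => k _.
  exact/analytic_atZ/af.
apply: eq_bigr => k _; rewrite jE //.
by apply: analytic_disk_algebra; exact: af.
Qed.

(** Sequential form of the continuity of the inclusion, with uniform
    convergence on the closed disk made explicit. *)
Lemma inclusion_cvg f (u : nat -> C -> C) : disk_algebra f ->
  (forall n, disk_algebra (u n)) ->
  (forall e : R, 0 < e -> \forall n \near \oo, forall z, modc z <= 1 ->
     modc (f z - u n z) <= e) ->
  (fun n => j (u n)) @ \oo --> j f.
Proof.
move=> df du uf; have [_ /subspace_continuousP jc] := hA.
have {}jc := jc f df.
move=> W jW; have := jc W jW.
rewrite /within /= => /uniform_nbhs[E [entE EW]].
have [e /= /gt0_real[d d0 ->] eE] : exists2 e : C, 0 < e &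
    [set xy | ball xy.1 e xy.2] `<=` E.
  by have := entE; rewrite -entourage_ballE.
have := uf (d / 2); rewrite divr_gt0 // => /(_ isT).
apply: filterS => n hn.
suff H z : cdisk z -> E (f z, u n z) by exact: (EW (u n) H (du n)).
move=> /cdiskE z1; apply: eE; rewrite /= -ball_normE /= normr_modc ltc_real.
by apply: le_lt_trans (hn z z1) _; lra.
Qed.

(** Closed disks of radius less than one are among the compact sets that
    define the topology of the space of analytic functions. *)
Lemma cvg0_locally_uniform (u : nat -> X) (r e : R) :
  0 < r < 1 -> 0 < e -> u @ \oo --> 0 ->
  \forall n \near \oo, forall z, modc z <= r -> modc (ev (u n) z) <= e.
Proof.
move=> /andP[r0 r1] e0 u0.
have rd z : modc z <= r -> disk z.
  by move=> zr; apply/diskE; apply: le_lt_trans r1.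
have h0 := @hH (0 : X).
have := cvg_comp _ _ u0 h0.
move=> /fam_cvgP/(_ [set z | modc z <= r]) H.
have {}H := H (conj (@compact_modc_le R r) rd).
have : \forall n \near \oo,
    [set g : C -> C | forall z, modc z <= r -> modc (ev 0 z - g z) < e] (ev (u n)).
  apply: H; apply/uniform_nbhs.
  exists [set xy : C * C | modc (xy.1 - xy.2) < e]; split => //.
  rewrite -entourage_ballE; exists e%:C => /=; first by rewrite ltc_real.
  by move=> [x y] /=; rewrite -ball_normE /= normr_modc ltc_real.
apply: filterS => n /= hn z zr; have := hn z zr.
by rewrite ev0 ?sub0r ?modcN; [exact: ltW|exact: rd].
Qed.

End Embedding.

End Space.

Theorem corollary5p2 (R : realType) (X : completeNormedModType (Cplx R))
    (ev : X -> Cplx R -> Cplx R) (j : (Cplx R -> Cplx R) -> X) (lam : nat -> Cplx R)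
    (hX : space_of_analytic_functions ev)
    (hA : disk_algebra_embedded ev j)
    (hH : embedded_in_hol_disk ev)
    (hlam : forall n, (1 <= n)%N -> `|lam n| < 1)
    (hsum : (\sum_(1 <= n <oo) (1 - Normc.normc (lam n))%:E = +oo)%E) :
  schauder_basis (j @` @hol_cdisk R) (fun n => j (blaschke lam n)).
Proof.
have lam1 n : (1 <= n)%N -> modc (lam n) < 1.
  by move=> n1; apply/diskE; exact: hlam.
have aB k (z : Cplx R) : modc z <= 1 -> analytic_at (blaschke lam k) z.
  exact: analytic_at_blaschke.
have dB k : disk_algebra (blaschke lam k).
  by apply: analytic_disk_algebra; exact: aB.
split=> [n|_ [f hf <-]].
  by exists (blaschke lam n) => //; exact: blaschke_hol_cdisk.
have [rho rho1 af] := hol_cdisk_radius hf.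
have [a ha] := blaschke_expansion lam1 hsum rho1 af.
have df : disk_algebra f.
  by apply: analytic_disk_algebra => z z1; apply/af/(le_trans z1)/ltW.
have ca : series (fun n => a n *: j (blaschke lam n)) @ \oo --> j f.
  rewrite (_ : series _ =
    fun n => j (fun z => \sum_(0 <= k < n) a k * blaschke lam k z)).
    apply: (inclusion_cvg hA df) => [n|e e0].
      apply: analytic_disk_algebra => z z1; apply: analytic_at_sum => k _.
      exact/analytic_atZ/aB.
    have [n0 hn] := ha e e0; exists n0.+1 => // -[//|n] /= n0n z z1.
    exact: hn.
  by apply/funext => n; rewrite (inclusion_sum hX hA).
exists a; split=> // b cb.
apply/funext => p; apply/eqP; rewrite -subr_eq0; apply/eqP.
apply: (blaschke_coef_unique lam1 (d := fun k => a k - b k)) => r e r01 e0.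
have c0 : series (fun n => (a n - b n) *: j (blaschke lam n)) @ \oo --> (0 : X).
  rewrite -(subrr (j f)).
  rewrite (_ : series _ = fun n => series (fun n => a n *: j (blaschke lam n)) n
     - series (fun n => b n *: j (blaschke lam n)) n); first exact: cvgB.
  apply/funext => n; rewrite /series /= -sumrB; apply: eq_bigr => k _.
  by rewrite scalerBl.
have [n0 _ hn] := cvg0_locally_uniform hX hH r01 e0 c0.
exists n0 => n z n0n zr; have := hn n n0n z zr.
have dz : disk z by apply/diskE; case/andP: r01 => _; exact: le_lt_trans.
rewrite [series _]/series /= (ev_sum hX _ _ _ dz).
rewrite (eq_bigr (fun k => (a k - b k) * blaschke lam k z)); first exact: id.
by move=> k _; have [jE _] := hA; congr (_ * _); exact: jE (dB k) z dz.
Qed.
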